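(* Let $(G,S)$ be a Cayley graph of a group of polynomial growth with homogeneous dimension $N\geq3$, let $1<p<\frac N2$ and $q>p^{\ast\ast}:=\frac{Np}{N-2p}$. Then there is a positive ground state solution $u\in D^{2,p}(G)$ of the nonlinear $p$-biharmonic equation $$\Delta\left(|\Delta u|^{p-2}\Delta u\right)-|u|^{q-2}u=0\quad\text{on } G.$$
   Context: $G$ is a finitely generated group and $S$ a finite generating set with $S=S^{-1}$. The Cayley graph $(G,S)$ has vertex set $G$, and $x\sim y$ iff $x=ys$ for some $s\in S$. $\beta_S(n)$ is the number of elements of $G$ at word distance at most $n$ from the unit element. $G$ is of polynomial growth with homogeneous dimension $N\in\mathbb N$ if there are constants $C_1,C_2>0$ depending on $S$ with $C_1n^N\le\beta_S(n)\le C_2n^N$ for all $n\ge1$. For $u:G\to\mathbb R$, $\Delta u(x):=\sum_{y\sim x}(u(y)-u(x))$, $\lVert u\rVert_{D^{2,p}(G)}:=\lVert\Delta u\rVert_{\ell^p(G)}$, and $D^{2,p}(G):=\{u\in\ell^{\frac{Np}{N-2p}}(G):\lVert u\rVert_{D^{2,p}(G)}<\infty\}$. Positive means $u(x)>0$ for every $x\in G$. A ground state solution is a nontrivial solution in $D^{2,p}(G)$ which minimizes the energy $J(w)=\frac1p\lVert\Delta w\rVert_{\ell^p(G)}^p-\frac1q\lVert w\rVert_{\ell^q(G)}^q$ among all nontrivial solutions $w\in D^{2,p}(G)$ of the equation. *)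

(* Defs.v *)
From HB Require Import structures.
From mathcomp Require Import all_boot all_order all_algebra.
From mathcomp Require Import finmap.
From mathcomp Require Import all_classical all_reals all_analysis.

Set Implicit Arguments.
Unset Strict Implicit.
Unset Printing Implicit Defensive.

Import Order.TTheory GRing.Theory Num.Theory.
Import numFieldNormedType.Exports.

Local Open Scope classical_set_scope.
Local Open Scope ring_scope.

Definition is_subgroup (G : groupType) (H : set G) : Prop :=
  [/\ H 1%g, forall x y, H x -> H y -> H (x * y)%g & forall x, H x -> H (x^-1)%g].

Definition generates (G : groupType) (S : set G) : Prop :=
  smallest (@is_subgroup G) S = [set: G].

Definition cayley_generators (G : groupType) (S : set G) : Prop :=
  [/\ finite_set S, forall s, S s <-> S (s^-1)%g & generates S].

Definition cayley_adj (G : groupType) (S : set G) (x y : G) : Prop :=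
  exists2 s, S s & x = (y * s)%g.

(* Since S is closed under inverses, the word distance from 1 to g is the least
   length of a word in S with product g. *)
Definition word_ball (G : groupType) (S : set G) (n : nat) : set G :=
  [set g | exists w : seq G,
    [/\ (size w <= n)%N, forall s, s \in w -> S s & g = (\prod_(s <- w) s)%g]].

(* fset_set is meaningful only on finite sets; word_ball S n is finite because
   S is. *)
Definition growth (G : groupType) (S : set G) (n : nat) : nat :=
  #|` fset_set (word_ball S n)|.

Definition polynomial_growth (R : realType) (G : groupType) (S : set G)
    (N : nat) : Prop :=
  exists C1 C2 : R, [/\ 0 < C1, 0 < C2 &
    forall n : nat, (1 <= n)%N ->
      C1 * n%:R ^+ N <= (growth S n)%:R <= C2 * n%:R ^+ N].

(* The sum runs over the set of neighbours of x, which is finite because S is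
   (fsbig would be 0 on an infinite support). *)
Definition laplacian (R : realType) (G : groupType) (S : set G)
    (u : G -> R) (x : G) : R :=
  \sum_(y \in [set y | cayley_adj S y x]) (u y - u x).

Definition lp_norm (R : realType) (G : groupType) (r : R) (u : G -> R) : \bar R :=
  ((\esum_(x in [set: G]) (`|u x| `^ r)%:E) `^ r^-1)%E.

Definition D2_norm (R : realType) (G : groupType) (S : set G) (p : R)
    (u : G -> R) : \bar R :=
  lp_norm p (laplacian S u).

Definition critical_exponent (R : realType) (N : nat) (p : R) : R :=
  N%:R * p / (N%:R - 2 * p).

Definition D2 (R : realType) (G : groupType) (S : set G) (N : nat) (p : R) :
    set (G -> R) :=
  [set u | (lp_norm (critical_exponent N p) u < +oo)%E /\
           (D2_norm S p u < +oo)%E].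

(* t |-> |t|^(r-2) t.  For r > 1 its value at 0 is 0, also when r < 2. *)
Definition signed_power (R : realType) (r t : R) : R := `|t| `^ (r - 2) * t.

Definition p_biharmonic_solution (R : realType) (G : groupType) (S : set G)
    (p q : R) (u : G -> R) : Prop :=
  forall x : G,
    laplacian S (fun y => signed_power p (laplacian S u y)) x
      - signed_power q (u x) = 0.

(* Both terms are finite on D2 S N p when q >= critical_exponent N p, so the
   subtraction is never of the form +oo - +oo there. *)
Definition energy (R : realType) (G : groupType) (S : set G) (p q : R)
    (w : G -> R) : \bar R :=
  (p^-1%:E * lp_norm p (laplacian S w) `^ p - q^-1%:E * lp_norm q w `^ q)%E.

Definition nontrivial_solution (R : realType) (G : groupType) (S : set G)
    (N : nat) (p q : R) (u : G -> R) : Prop :=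
  [/\ D2 S N p u, u <> (fun=> 0) & p_biharmonic_solution S p q u].

Definition ground_state (R : realType) (G : groupType) (S : set G)
    (N : nat) (p q : R) (u : G -> R) : Prop :=
  nontrivial_solution S N p q u /\
  forall w : G -> R, nontrivial_solution S N p q w ->
    (energy S p q u <= energy S p q w)%E.

(* Main.v *)
Require Import Defs.
From HB Require Import structures.
From mathcomp Require Import all_boot all_order all_algebra.
From mathcomp Require Import finmap.
From mathcomp Require Import all_classical all_reals all_analysis.
From mathcomp Require Import ring lra.

Set Implicit Arguments.
Unset Strict Implicit.
Unset Printing Implicit Defensive.

Import Order.TTheory GRing.Theory Num.Theory.
Import numFieldNormedType.Exports.

Local Open Scope classical_set_scope.
Local Open Scope ring_scope.

(** Put K = (- Delta)^-1.  On a group of growth exponent N the operator K maps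
    l^p to l^r as soon as 1/p - 1/r > 2/N.  The condition q > p** says precisely
    that (p, q) is such a pair, and then the dual pair (q/(q-1), p/(p-1)) is one
    too.  Writing u = K f, the equation becomes f^(p-1) = K (u^(q-1)), which is,
    up to scaling, the Euler-Lagrange equation of
      M = sup { sum (K f)^q : f >= 0, sum f^p <= 1 }.

    The bound on K comes from the decay of a heat kernel on the diagonal.  Let P
    be the lazy random walk, so that K is a multiple of the sum of the P^n.
    Averaging over balls turns volume growth into a Nash inequality (nash);
    this forces the kernel of P^n to decay like n^(-N/2) (heat_bound), whence
    P^n f decays like n^(-N/2p) uniformly for f in l^p, and summing over n gives
    green_sobolev.

    An extremal function exists by compactness without loss of mass
    (extremal_exists).  Since q exceeds the critical exponent, the values of
    K f_n cannot all become small, and left translations keep K f_n (1) away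
    from 0 (nonvanishing).  Near equality in Young's inequality for the pairing
    of f_n with K ((K f_n)^(q-1)) / M holds term by term, so the Euler-Lagrange
    equation passes to a pointwise limit f <> 0 (euler_lagrange_defect).  Pairing that equation with f gives
    sum f^p <= (sum f^p)^(q/p); as q > p this forces sum f^p = 1, so the limit
    is again extremal.  A bootstrap in the exponents puts K f in the critical
    space (extremal_critical_summable), and K f is superharmonic and nonzero,
    hence positive.

    For minimality, let w be any nontrivial solution.  A harmonic function
    which vanishes at infinity is zero, so w and |Delta w|^(p-2) Delta w are
    potentials of their own Laplacians (green_representation).  Symmetry of K
    then gives sum |Delta w|^p = sum |w|^q = A (solution_identity), so that the
    energy of w is (1/p - 1/q) A, while the Sobolev inequality gives
    A <= M A^(q/p).  The rescaled extremal function attains the resulting lower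
    bound for A. *)

(** * Inequalities for real powers *)

Section RealInequalities.
Context {R : realType}.
Implicit Types r y t : R.

Lemma powR_gt0_expR t r : 0 < t -> t `^ r = expR (r * ln t).
Proof. by move=> t0; rewrite /powR gt_eqF. Qed.

(** Divide by e^z and apply 1 + x <= e^x at x = (r - 1) z and at x = - z:
    the terms in z cancel. *)
Lemma powR_tangent_normalized r z : 1 <= r ->
  r * expR z <= expR (r * z) + (r - 1).
Proof.
move=> r1.
have -> : expR (r * z) + (r - 1) =
    expR z * (expR ((r - 1) * z) + (r - 1) * expR (- z)).
  rewrite mulrDr -expRD mulrCA -expRD subrr expR0 mulr1.
  by congr (expR _ + _); lra.
rewrite mulrC ler_pM2l ?expR_gt0//.
have h1 := expR_ge1Dx ((r - 1) * z).
have h2 := expR_ge1Dx (- z).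
have h3 : (r - 1) * (1 - z) <= (r - 1) * expR (- z).
  by apply: ler_wpM2l; rewrite ?subr_ge0.
lra.
Qed.

Lemma powR_tangent_normalized_eq r z : 1 < r ->
  r * expR z = expR (r * z) + (r - 1) -> z = 0.
Proof.
move=> r1; apply: contraPP => /eqP z0 /eqP; apply/negP.
have -> : expR (r * z) + (r - 1) =
    expR z * (expR ((r - 1) * z) + (r - 1) * expR (- z)).
  rewrite mulrDr -expRD mulrCA -expRD subrr expR0 mulr1.
  by congr (expR _ + _); lra.
rewrite lt_eqF// mulrC ltr_pM2l ?expR_gt0//.
have h1 := expR_ge1Dx ((r - 1) * z).
have h2 : 1 - z < expR (- z) by apply: expR_gt1Dx; rewrite oppr_eq0.
have h3 : (r - 1) * (1 - z) < (r - 1) * expR (- z).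
  by rewrite ltr_pM2l// subr_gt0.
lra.
Qed.

(** Convexity of t |-> t^r, written as the position of its graph above the
    tangent at y.  This one inequality serves below as Bernoulli's, Young's and
    Jensen's inequality; with z = ln (t / y) it reads
    r e^z <= e^(r z) + r - 1, a combination of two instances of
    1 + x <= e^x. *)
Lemma powR_tangent r y t : 1 <= r -> 0 <= y -> 0 <= t ->
  r * y `^ (r - 1) * t <= t `^ r + (r - 1) * y `^ r.
Proof.
move=> r1; rewrite le_eqVlt => /predU1P[<-|y0] t0.
  have [->|r1'] := eqVneq r 1.
    by rewrite subrr powRr0 !mul1r mul0r addr0 powRr1.
  rewrite powR0 ?subr_eq0// mulr0 mul0r addr_ge0 ?powR_ge0// mulr_ge0 ?powR_ge0//.
  by rewrite subr_ge0.
move: t0; rewrite le_eqVlt => /predU1P[<-|t0].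
  by rewrite mulr0 addr_ge0 ?powR_ge0// mulr_ge0 ?powR_ge0// subr_ge0.
have := powR_tangent_normalized (ln (t / y)) r1.
rewrite -powR_gt0_expR ?divr_gt0// lnK ?posrE ?divr_gt0//.
have yr : 0 < y `^ r by apply: powR_gt0.
rewrite -(ler_pM2r yr) mulrDl -powRM ?divr_ge0 ?(ltW t0) ?(ltW y0)//.
rewrite divfK ?gt_eqF// => h; apply: le_trans h; rewrite le_eqVlt; apply/orP; left.
by apply/eqP; rewrite -[in RHS](mulr_powRB1 (ltW y0))//; [field; rewrite gt_eqF|lra].
Qed.

(** The case of equality is what yields the Euler-Lagrange equation of a
    maximizing sequence. *)
Lemma powR_tangent_eq r y t : 1 < r -> 0 <= y -> 0 <= t ->
  r * y `^ (r - 1) * t = t `^ r + (r - 1) * y `^ r -> t = y.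
Proof.
move=> r1; rewrite le_eqVlt => /predU1P[<-|y0] t0.
  rewrite !powR0 ?gt_eqF ?subr_gt0//; last by lra.
  by rewrite !mulr0 mul0r addr0 => /esym/powR_eq0_eq0.
move: t0; rewrite le_eqVlt => /predU1P[<-|t0].
  rewrite mulr0 powR0 ?gt_eqF//; last by lra.
  rewrite add0r => /esym/eqP; rewrite gt_eqF// mulr_gt0 ?powR_gt0 ?subr_gt0//.
move=> h; have := @powR_tangent_normalized_eq r (ln (t / y)) r1.
rewrite -powR_gt0_expR ?divr_gt0// lnK ?posrE ?divr_gt0// => h1.
have yr : 0 < y `^ r by apply: powR_gt0.
suff /eqP : ln (t / y) = 0.
  rewrite ln_eq0 ?divr_gt0// => /eqP ty.
  by rewrite -[LHS](@divfK _ y) ?gt_eqF// ty mul1r.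
apply: h1; apply: (mulIf (lt0r_neq0 yr)).
rewrite mulrDl -powRM ?divr_ge0 ?ltW// divfK ?gt_eqF// -h.
rewrite -[in LHS](mulr_powRB1 (ltW y0)); last by lra.
by field; rewrite gt_eqF.
Qed.

Lemma powRN_bernoulli (a t : R) : 0 <= a -> 0 <= t < 1 ->
  1 + a * t <= (1 - t) `^ (- a).
Proof.
move=> a0 /andP[t0 t1].
rewrite powR_gt0_expR ?subr_gt0//.
apply: (le_trans _ (expR_ge1Dx _)); rewrite lerD2l mulNr -mulrN ler_wpM2l//.
have := @le_ln1Dx R (- t); rewrite ltrN2 => /(_ t1); lra.
Qed.

Lemma powRV (t r : R) : t^-1 `^ r = t `^ (- r).
Proof.
have [t0|t0] := leP 0 t; last first.
  by rewrite !lt0_powR1 ?invr_lt0.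
by rewrite -powR_inv1// -powRrM mulN1r.
Qed.

Lemma powRK (t r : R) : 0 <= t -> r != 0 -> (t `^ r) `^ r^-1 = t.
Proof. by move=> t0 r0; rewrite -powRrM mulfV// powRr1. Qed.

Lemma powRVK (t r : R) : 0 <= t -> r != 0 -> (t `^ r^-1) `^ r = t.
Proof. by move=> t0 r0; rewrite -powRrM mulVf// powRr1. Qed.

Lemma ler_powR_base (x y r : R) : 0 <= r -> 0 <= x -> x <= y -> x `^ r <= y `^ r.
Proof.
by move=> r0 x0 xy; rewrite ge0_ler_powR ?nnegrE//; exact: le_trans xy.
Qed.

Lemma powR_lerP (x y r : R) : 0 < r -> 0 <= x -> 0 <= y ->
  x `^ r <= y `^ r -> x <= y.
Proof.
move=> r0 x0 y0 xy; rewrite -(powRK x0 (lt0r_neq0 r0)) -(powRK y0 (lt0r_neq0 r0)).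
by apply: ler_powR_base xy; rewrite ?invr_ge0 ?powR_ge0 ?(ltW r0).
Qed.

(** Comparison with an integral, in the discrete form that makes the sum
    telescope. *)
Lemma riemann_telescope (a : R) (m : nat) : 0 < a ->
  (m.+2)%:R `^ (- (a + 1)) <= a^-1 * (m.+1%:R `^ (- a) - m.+2%:R `^ (- a)).
Proof.
move=> a0; set y : R := m.+2%:R.
have y0 : 0 < y by rewrite ltr0n.
have yN : y != 0 by rewrite gt_eqF.
have -> : m.+1%:R = y * (1 - y^-1).
  by rewrite mulrBr mulr1 mulfV// /y -[m.+2%:R]natr1 addrK.
have y1 : 1 - y^-1 \in `[0, 1].
  by rewrite in_itv/= subr_ge0 invf_le1// ler1n/= gerBl invr_ge0 ltW.
rewrite powRM ?(ltW y0)//; last by move: y1; rewrite in_itv/= => /andP[].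
rewrite -[X in _ * (_ - X)]mulr1 -mulrBr mulrCA opprD powRD ?yN ?implybT//.
rewrite powR_inv1 ?(ltW y0)// ler_pM2l ?powR_gt0// ler_pdivlMl//.
have := @powRN_bernoulli a y^-1 (ltW a0).
rewrite invr_ge0 (ltW y0) /= invf_lt1// ltr1n => /(_ isT); rewrite -lerBrDl; exact.
Qed.

Lemma sum_riemann_tail (a : R) (m n : nat) : 0 < a ->
  \sum_(m.+1 <= k < m.+1 + n) k.+1%:R `^ (- (a + 1)) <= a^-1 * m.+1%:R `^ (- a).
Proof.
move=> a0.
suff : \sum_(m.+1 <= k < m.+1 + n) k.+1%:R `^ (- (a + 1)) <=
    a^-1 * (m.+1%:R `^ (- a) - (m + n).+1%:R `^ (- a)).
  move=> /le_trans; apply; rewrite ler_pM2l ?invr_gt0// gerBl powR_ge0//.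
elim: n => [|n IH]; first by rewrite addn0 big_geq// addn0 subrr mulr0.
rewrite addnS big_nat_recr; last exact: leq_addr.
apply: (le_trans (lerD IH (riemann_telescope _ a0))).
rewrite -mulrDr subrKA addnS; exact: lexx.
Qed.

End RealInequalities.

(** * Sums of nonnegative functions *)

Section NonnegativeSums.
Context {R : realType}.
Local Open Scope ereal_scope.

Definition tsum (T : choiceType) (f : T -> R) : \bar R :=
  \esum_(x in [set: T]) (f x)%:E.

Section Basic.
Context {T : choiceType}.
Implicit Types f g e : T -> R.

Lemma tsum_ge0 f : (forall x, 0 <= f x)%R -> 0 <= tsum f.
Proof. by move=> f0; apply: esum_ge0 => x _; rewrite lee_fin. Qed.

Lemma le_tsum f g : (forall x, f x <= g x)%R -> tsum f <= tsum g.
Proof. by move=> fg; apply: le_esum => x _; rewrite lee_fin. Qed.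

Lemma eq_tsum f g : f =1 g -> tsum f = tsum g.
Proof. by move=> /funext ->. Qed.

Lemma tsumD f g : (forall x, 0 <= f x)%R -> (forall x, 0 <= g x)%R ->
  tsum (fun x => f x + g x)%R = tsum f + tsum g.
Proof.
by move=> f0 g0; rewrite /tsum -esumD// => x _; rewrite lee_fin.
Qed.

Lemma tsum_sum (I : choiceType) (r : seq I) (F : I -> T -> R) :
  (forall i x, 0 <= F i x)%R ->
  tsum (fun x => \sum_(i <- r) F i x)%R = \sum_(i <- r) tsum (F i).
Proof.
move=> F0; rewrite /tsum -esum_sum; last by move=> i j _ _; rewrite lee_fin.
by apply: eq_esum => x _; rewrite sumEFin.
Qed.

Lemma finsum_le_tsum f (X : {fset T}) : (\sum_(x <- X) f x)%:E <= tsum f.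
Proof.
apply: esum_ge; exists [set` X]; first by split=> //; exact: finite_fset.
by rewrite fsbig_finite ?finite_fset//= set_fsetK sumEFin.
Qed.

Lemma tsum_le_finsum f (A : \bar R) :
  (forall X : {fset T}, (\sum_(x <- X) f x)%:E <= A) -> tsum f <= A.
Proof.
move=> h; apply: ge_ereal_sup => _ [X [finX _] <-].
by rewrite fsbig_finite//= sumEFin.
Qed.

Lemma term_le_tsum f x : (f x)%:E <= tsum f.
Proof. by have := finsum_le_tsum f [fset x]%fset; rewrite big_seq_fset1. Qed.

Lemma tsum_fineK f : (forall x, 0 <= f x)%R -> tsum f < +oo ->
  tsum f = (fine (tsum f))%:E.
Proof. by move=> f0 h; rewrite fineK// ge0_fin_numE// tsum_ge0. Qed.

Lemma tsumZ (c : R) f : (0 <= c)%R -> (forall x, 0 <= f x)%R ->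
  tsum (fun x => c * f x)%R = c%:E * tsum f.
Proof.
move=> c0 f0; apply/eqP; rewrite eq_le; apply/andP; split.
  apply: tsum_le_finsum => X; rewrite -mulr_sumr EFinM.
  by rewrite lee_wpmul2l ?lee_fin// finsum_le_tsum.
have [->|cn0] := eqVneq c 0%R.
  by rewrite mul0e tsum_ge0// => x; rewrite mul0r.
have {cn0}c0 : (0 < c)%R by rewrite lt_neqAle eq_sym cn0.
rewrite -lee_pdivlMl//; apply: tsum_le_finsum => X.
rewrite lee_pdivlMl// -EFinM mulr_sumr; exact: finsum_le_tsum.
Qed.

Lemma tsum_reindex f (h : T -> T) : bijective h -> tsum (f \o h) = tsum f.
Proof.
move=> bh; rewrite /tsum [RHS](reindex_esum setT setT h)//.
split=> //; first by move=> x y _ _; apply: bij_inj.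
by move=> y _ /=; case: bh => k hk kh; exists (k y).
Qed.

Lemma tsum_gt0 f x : (forall x, 0 <= f x)%R -> (0 < f x)%R -> 0 < tsum f.
Proof. by move=> f0 fx; apply: lt_le_trans (term_le_tsum f x); rewrite lte_fin. Qed.

(** Hoelder's inequality with the second function given as the (r-1)-st power
    of a function in l^r, the form in which it is met below: no conjugate
    exponent appears, and the proof is powR_tangent applied to f / A
    and e / B. *)
Lemma hoelder_tsum (r A B : R) f e : (1 <= r)%R -> (0 < A)%R -> (0 < B)%R ->
  (forall x, 0 <= f x)%R -> (forall x, 0 <= e x)%R ->
  tsum (fun x => f x `^ r)%R <= (A `^ r)%:E ->
  tsum (fun x => e x `^ r)%R <= (B `^ r)%:E ->
  tsum (fun x => f x * e x `^ (r - 1))%R <= (A * B `^ (r - 1))%:E.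
Proof.
move=> r1 A0 B0 f0 e0 hf he.
have r0 : (0 < r)%R by apply: lt_le_trans r1.
have key x : (f x * e x `^ (r - 1) <= A * B `^ (r - 1) / r *
    ((A `^ r)^-1 * f x `^ r + (r - 1) / B `^ r * e x `^ r))%R.
  have := powR_tangent r1 (divr_ge0 (e0 x) (ltW B0)) (divr_ge0 (f0 x) (ltW A0)).
  rewrite !powRM ?invr_ge0 ?(ltW A0) ?(ltW B0)// !powRV !powRN => h.
  have c0 : (0 <= A * B `^ (r - 1) / r)%R.
    by rewrite divr_ge0 ?(ltW r0)// mulr_ge0 ?powR_ge0// ltW.
  have := ler_wpM2l c0 h.
  have Bn : (B `^ (r - 1) != 0)%R by rewrite gt_eqF// powR_gt0.
  set b := (B `^ (r - 1))%R in Bn *.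
  have -> : (A * b / r * (r * (e x `^ (r - 1) / b) * (f x / A)) =
    f x * e x `^ (r - 1))%R.
    by field; rewrite Bn !gt_eqF.
  move=> /le_trans; apply; rewrite le_eqVlt; apply/orP; left; apply/eqP.
  by congr (_ * _)%R; rewrite [(f x `^ r / _)%R]mulrC mulrAC mulrA.
apply: (le_trans (le_tsum key)).
have Ar : (0 <= (A `^ r)^-1)%R by rewrite invr_ge0 powR_ge0.
have Br : (0 <= (r - 1) / B `^ r)%R.
  by rewrite divr_ge0 ?powR_ge0// subr_ge0.
rewrite tsumZ; last 2 first.
- by rewrite divr_ge0 ?(ltW r0)// mulr_ge0 ?powR_ge0// ltW.
- by move=> x; rewrite addr_ge0// mulr_ge0// powR_ge0.
rewrite tsumD; try by move=> x; rewrite mulr_ge0// powR_ge0.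
rewrite !tsumZ//; try by move=> x; rewrite powR_ge0.
apply: (@le_trans _ _ ((A * B `^ (r - 1) / r)%:E *
  (((A `^ r)^-1)%:E * (A `^ r)%:E + ((r - 1) / B `^ r)%:E * (B `^ r)%:E))).
  apply: lee_wpmul2l.
    by rewrite lee_fin divr_ge0 ?(ltW r0)// mulr_ge0 ?powR_ge0// ltW.
  by apply: leeD; apply: lee_wpmul2l => //; rewrite lee_fin.
rewrite -!EFinM. rewrite lee_fin le_eqVlt; apply/orP; left; apply/eqP.
by field; rewrite !gt_eqF ?powR_gt0.
Qed.

End Basic.

Lemma tsum_nat_le (a : nat -> R) (A : R) : (forall n, 0 <= a n)%R ->
  (forall n, \sum_(0 <= k < n) a k <= A)%R -> tsum a <= A%:E.
Proof.
move=> a0 h; rewrite /tsum -nneseries_esumT; last by move=> n; rewrite lee_fin.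
apply: lime_le; first by apply: is_cvg_nneseries => n _ _; rewrite lee_fin.
by apply: nearW => n; rewrite sumEFin lee_fin.
Qed.

Lemma sum_nat_le_tsum (a : nat -> R) n : (forall n, 0 <= a n)%R ->
  (\sum_(0 <= k < n) a k)%:E <= tsum a.
Proof.
move=> a0; rewrite /tsum -nneseries_esumT; last by move=> k; rewrite lee_fin.
rewrite -sumEFin; by apply: nneseries_lim_ge => k _; rewrite lee_fin.
Qed.

Lemma esum_swap (T U : choiceType) (a : T -> U -> \bar R) :
  (forall x y, 0 <= a x y) ->
  \esum_(x in [set: T]) \esum_(y in [set: U]) a x y =
  \esum_(y in [set: U]) \esum_(x in [set: T]) a x y.
Proof.
move=> a0; rewrite !esum_esum//.
rewrite (reindex_esum ([set: U] `*`` (fun=> [set: T])) _ (fun x => (x.2, x.1)))//.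
split=> //=.
  by move=> [i1 i2] [j1 j2] /= _ _ [] -> ->.
by move=> [i1 i2] [Pi1 Qi2] /=; exists (i2, i1).
Qed.

End NonnegativeSums.

Section RealSums.
Context {R : realType}.

Lemma sume_cst (I : Type) (r : seq I) (c : \bar R) : (0 <= c)%E ->
  (\sum_(i <- r) c = (size r)%:R%:E * c)%E.
Proof.
move=> c0; elim: r => [|i r IH]; first by rewrite big_nil mul0e.
by rewrite big_cons IH/= -natr1 EFinD ge0_muleDl// ?lee_fin// mul1e addeC.
Qed.

Lemma tsum_nat_recl (a : nat -> R) : (forall n, 0 <= a n) ->
  tsum a = ((a 0%N)%:E + tsum (fun n => a n.+1))%E.
Proof.
move=> a0; rewrite /tsum -!nneseries_esumT; try by move=> n; rewrite lee_fin.
rewrite nneseries_recl//; last by move=> n _; rewrite lee_fin.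
rewrite -(nneseries_addn 1); last by move=> n; rewrite lee_fin.
by under eq_eseriesr do rewrite addn1.
Qed.

(** Jensen's inequality for the measure with weights w, applied to a / w.  It
    replaces Minkowski's inequality when an infinite series of functions is
    estimated in l^r. *)
Lemma tsum_jensen (r : R) (w a : nat -> R) (u : R) : 1 <= r ->
  (forall n, 0 < w n) -> (tsum w <= 1)%E -> (forall n, 0 <= a n) -> 0 <= u ->
  tsum a = u%:E ->
  ((u `^ r)%:E <= tsum (fun n => w n `^ (1 - r) * a n `^ r)%R)%E.
Proof.
move=> r1 w0 w1 a0 u0 au.
have r0 : 0 < r by apply: lt_le_trans r1.
have rm1 : 0 <= r - 1 by rewrite subr_ge0.
have key n : r * u `^ (r - 1) * a n <=
    w n `^ (1 - r) * a n `^ r + (r - 1) * u `^ r * w n.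
  have wn := w0 n.
  have -> : r * u `^ (r - 1) * a n = r * u `^ (r - 1) * (a n / w n) * w n.
    by rewrite -[RHS]mulrA divfK ?gt_eqF.
  have := powR_tangent r1 u0 (divr_ge0 (a0 n) (ltW wn)).
  move=> /(ler_wpM2r (ltW wn)) /le_trans; apply.
  rewrite mulrDl powRM ?invr_ge0 ?(ltW wn)// powRV.
  rewrite lerD2r -mulrA mulrC ler_wpM2r ?powR_ge0//.
  by rewrite -{2}(powRr1 (ltW wn)) -powRD ?(gt_eqF wn) ?implybT// addrC.
have := le_tsum key.
rewrite tsumZ//; last by rewrite mulr_ge0 ?powR_ge0// ltW.
rewrite tsumD; last 2 first.
- by move=> n; rewrite mulr_ge0 ?powR_ge0.
- by move=> n; rewrite !mulr_ge0 ?powR_ge0 ?(ltW (w0 n)).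
rewrite [X in (_ <= _ + X)%E]tsumZ; last 2 first.
- by rewrite mulr_ge0 ?powR_ge0.
- by move=> n; exact: ltW.
set T := (X in (_ <= X + _)%E); rewrite au -EFinM -mulrA [_ `^ _ * u]mulrC mulr_powRB1// => h.
have {}h : ((r * u `^ r)%:E <= T + ((r - 1) * u `^ r)%:E)%E.
  apply: (le_trans h); rewrite leeD2l// -[leRHS]mule1 lee_wpmul2l//.
  by rewrite lee_fin mulr_ge0 ?powR_ge0.
rewrite -(@leeD2rE _ ((r - 1) * u `^ r)%:E)//; apply: le_trans h.
by rewrite -EFinD lee_fin le_eqVlt; apply/orP; left; apply/eqP; ring.
Qed.

Section Powers.
Context {T : choiceType}.
Implicit Types u v : T -> R.

Lemma tsum_powR_le u v (r : R) : 0 <= r -> (forall x, 0 <= u x) ->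
  (forall x, u x <= v x) -> (tsum (fun x => v x `^ r)%R < +oo)%E ->
  (tsum (fun x => u x `^ r)%R < +oo)%E.
Proof.
by move=> r0 u0 uv; apply: le_lt_trans; apply: le_tsum => x; exact: ler_powR_base.
Qed.

(** Summability of a power bounds u, so that u^b is at most a constant times
    u^a. *)
Lemma lp_embedding u (a b : R) : 0 < a -> a <= b -> (forall x, 0 <= u x) ->
  (tsum (fun x => u x `^ a)%R < +oo)%E -> (tsum (fun x => u x `^ b)%R < +oo)%E.
Proof.
move=> a0 ab u0 fin.
have s0 x : 0 <= u x `^ a by exact: powR_ge0.
have sE := tsum_fineK s0 fin; set s := fine _ in sE.
have sge : 0 <= s by exact/fine_ge0/tsum_ge0.
have us x : u x <= s `^ a^-1.
  apply: (powR_lerP a0); rewrite ?powR_ge0// powRVK ?gt_eqF//.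
  by rewrite -lee_fin -sE; exact: (term_le_tsum (fun x => u x `^ a)).
apply: (@le_lt_trans _ _ (tsum (fun x => (s `^ a^-1) `^ (b - a) * u x `^ a))).
  apply: le_tsum => x.
  have b0 : b != 0 by rewrite gt_eqF// (lt_le_trans a0).
  rewrite -{1}(subrK a b) (@powRD _ _ (b - a) a) ?subrK ?(negbTE b0)//.
  by rewrite ler_wpM2r// ler_powR_base ?subr_ge0.
by rewrite tsumZ ?powR_ge0// sE -EFinM ltry.
Qed.

End Powers.

End RealSums.

(** * The lazy random walk *)

Section LazyWalk.
Context {R : realType} {G : groupType} (S : set G).
Implicit Types (f g u : G -> R) (x y : G).

Definition degree : R := #|` fset_set S|%:R.

(** The lazy walk stays put with probability 1/2.  Laziness makes the loss of
    l^2 mass in one step comparable to the Dirichlet energy, with no parity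
    obstruction. *)
Definition walk u x : R :=
  2^-1 * u x + (2 * degree)^-1 * \sum_(s <- fset_set S) u (x * s)%g.

Definition walkn n : (G -> R) -> G -> R := iter n walk.

Hypothesis hS : cayley_generators S.
Hypothesis S0 : S !=set0.

Let finS : finite_set S. Proof. by case: hS. Qed.

Lemma degree_gt0 : 0 < degree.
Proof.
rewrite /degree ltr0n cardfs_gt0; case: S0 => s Ss.
by apply/fset0Pn; exists s; rewrite in_fset_set// inE.
Qed.

Lemma laplacianE u x :
  laplacian S u x = \sum_(s <- fset_set S) (u (x * s)%g - u x).
Proof.
rewrite /laplacian (reindex_fsbig (fun s => (x * s)%g) S); last first.
  split; first by move=> s Ss /=; exists s.
    by move=> s t _ _; apply: mulgI.
  by move=> y [s Ss ->]; exists s.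
by rewrite fsbig_finite.
Qed.

Lemma laplacian_walk u x : laplacian S u x = 2 * degree * (walk u x - u x).
Proof.
rewrite laplacianE sumrB big_const_seq count_predT iter_addr_0 /walk.
rewrite -mulr_natr -/(degree) cardfE -cardfE -/degree.
by field; rewrite gt_eqF// degree_gt0.
Qed.

Lemma big_gens_inv (V : nmodType) (F : G -> V) :
  \sum_(s <- fset_set S) F (s^-1)%g = \sum_(s <- fset_set S) F s.
Proof.
rewrite -(big_map (fun s : G => s^-1)%g xpredT F); apply: perm_big.
apply: uniq_perm; rewrite ?fset_uniq// ?map_inj_uniq ?fset_uniq//.
  exact: invg_inj.
have [_ symS _] := hS.
move=> s; apply/mapP/idP => [[t + ->]|].
  by rewrite !in_fset_set// !inE => /symS.
rewrite in_fset_set// inE => Ss; exists (s^-1)%g; rewrite ?invgK//.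
by rewrite in_fset_set// inE; apply/symS; rewrite invgK.
Qed.

Lemma le_walk u v : (forall x, u x <= v x) -> forall x, walk u x <= walk v x.
Proof.
move=> uv x; apply: lerD; first by rewrite ler_pM2l ?invr_gt0.
rewrite ler_pM2l ?invr_gt0 ?mulr_gt0 ?degree_gt0//.
by apply: ler_sum => s _.
Qed.

Lemma walk_lin a b u v x :
  walk (fun y => a * u y + b * v y) x = a * walk u x + b * walk v x.
Proof. by rewrite /walk big_split/= -!mulr_sumr; ring. Qed.

Lemma walk_cst a x : walk (fun=> a) x = a.
Proof.
rewrite /walk big_const_seq count_predT iter_addr_0.
rewrite -mulr_natr -/degree.
by field; rewrite gt_eqF// degree_gt0.
Qed.

Lemma walk_translate (z : G) u x :
  walk (fun y => u (z * y)%g) x = walk u (z * x)%g.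
Proof. by rewrite /walk; under eq_bigr do rewrite mulgA. Qed.

Lemma le_walkn n u v : (forall x, u x <= v x) ->
  forall x, walkn n u x <= walkn n v x.
Proof. by move=> uv; elim: n => // n IH x; apply: le_walk. Qed.

Lemma walkn_lin n a b u v x :
  walkn n (fun y => a * u y + b * v y) x = a * walkn n u x + b * walkn n v x.
Proof.
elim: n x => // n IH x; rewrite -walk_lin /walkn/=.
by congr (walk _ x); apply/funext => y; exact: IH.
Qed.

Lemma walkn_cst n a x : walkn n (fun=> a) x = a.
Proof.
elim: n x => // n IH x; rewrite -[RHS](walk_cst a x) /walkn/=.
by congr (walk _ x); apply/funext => y; exact: IH.
Qed.

Lemma walkn_translate n (z : G) u x :
  walkn n (fun y => u (z * y)%g) x = walkn n u (z * x)%g.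
Proof.
elim: n x => // n IH x; rewrite /walkn/= -walk_translate.
by congr (walk _ x); apply/funext => y; exact: IH.
Qed.

Lemma walkn_ge0 n u : (forall x, 0 <= u x) -> forall x, 0 <= walkn n u x.
Proof.
by move=> u0 x; rewrite -[leLHS](walkn_cst n 0 x); apply: le_walkn.
Qed.

Lemma walk_ge0 u : (forall x, 0 <= u x) -> forall x, 0 <= walk u x.
Proof. by move=> u0; apply: (@walkn_ge0 1). Qed.

Lemma tsum_mulgr u (z : G) : tsum (fun x => u (x * z)%g) = tsum u.
Proof.
rewrite -[RHS](tsum_reindex _ (h := fun x => (x * z)%g))//.
by exists (fun x => x * z^-1)%g => x; rewrite -mulgA ?mulgV ?mulVg mulg1.
Qed.

Lemma tsum_mulgl u (z : G) : tsum (fun x => u (z * x)%g) = tsum u.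
Proof.
rewrite -[RHS](tsum_reindex _ (h := fun x => (z * x)%g))//.
by exists (fun x => z^-1 * x)%g => x; rewrite mulgA ?mulgV ?mulVg mul1g.
Qed.

(** The generating set is closed under inverses, so the walk is reversible. *)
Lemma tsum_walk_dual f g : (forall x, 0 <= f x) -> (forall x, 0 <= g x) ->
  tsum (fun x => f x * walk g x) = tsum (fun x => walk f x * g x).
Proof.
move=> f0 g0.
have c0 : 0 <= (2 * degree)^-1 by rewrite invr_ge0 mulr_ge0// ltW// degree_gt0.
have expand (u v : G -> R) : (forall x, 0 <= u x) -> (forall x, 0 <= v x) ->
    tsum (fun x => u x * walk v x) =
    ((2^-1)%:E * tsum (fun x => u x * v x)%R + (2 * degree)^-1%:E *
     \sum_(s <- fset_set S) tsum (fun x => u x * v (x * s)%g)%R)%E.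
  move=> u0 v0.
  rewrite -tsum_sum; last by move=> s x; rewrite mulr_ge0.
  rewrite -!tsumZ//; last 2 first.
  - by move=> x; apply: sumr_ge0 => s _; rewrite mulr_ge0.
  - by move=> x; rewrite mulr_ge0.
  rewrite -tsumD.
  - by apply: eq_tsum => x; rewrite /walk -mulr_sumr; ring.
  - by move=> x; rewrite !mulr_ge0.
  - by move=> x; rewrite mulr_ge0//; apply: sumr_ge0 => s _; rewrite mulr_ge0.
rewrite expand//.
have -> : tsum (fun x => walk f x * g x) = tsum (fun x => g x * walk f x).
  by apply: eq_tsum => x; rewrite mulrC.
rewrite expand//; congr (_ * _ + _ * _)%E.
  by apply: eq_tsum => x; rewrite mulrC.
rewrite -big_gens_inv; apply: eq_bigr => s _.
rewrite -(tsum_mulgr _ s); apply: eq_tsum => x.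
by rewrite mulgK mulrC.
Qed.

Lemma tsum_walkn_dual n f g : (forall x, 0 <= f x) -> (forall x, 0 <= g x) ->
  tsum (fun x => f x * walkn n g x) = tsum (fun x => walkn n f x * g x).
Proof.
move=> f0; elim: n g => // n IH g g0.
rewrite /walkn iterSr -/(walkn n) IH; last exact: walk_ge0.
by rewrite tsum_walk_dual//; exact: walkn_ge0.
Qed.

Lemma tsum_walkn n f : (forall x, 0 <= f x) -> tsum (walkn n f) = tsum f.
Proof.
move=> f0.
rewrite (@eq_tsum _ _ _ (fun x => walkn n f x * 1)); last by move=> x; rewrite mulr1.
rewrite -tsum_walkn_dual//; apply: eq_tsum => x.
by rewrite walkn_cst mulr1.
Qed.

(** The tangent to t |-> t^r at the value of the average, averaged. *)
Lemma walkn_jensen n (r : R) f x : 1 <= r -> (forall x, 0 <= f x) ->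
  walkn n f x `^ r <= walkn n (fun y => f y `^ r) x.
Proof.
move=> r1 f0; set y := walkn n f x.
have y0 : 0 <= y by apply: walkn_ge0.
have : walkn n (fun z => (r * y `^ (r - 1)) * f z + 0 * 0) x <=
    walkn n (fun z => 1 * f z `^ r + (r - 1) * y `^ r) x.
  by apply: le_walkn => z; rewrite mul0r addr0 mul1r; apply: powR_tangent.
rewrite !walkn_lin !walkn_cst -/y mul0r addr0 mul1r.
rewrite -mulrA [y `^ _ * y]mulrC mulr_powRB1//; last exact: lt_le_trans r1.
lra.
Qed.

End LazyWalk.

(** * A Nash inequality from volume growth *)

Section HeatDecay.
Context {R : realType} {G : groupType} (S : set G).
Implicit Types (f g u : G -> R) (x y : G).

Hypothesis hS : cayley_generators S.
Hypothesis S0 : S !=set0.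

Let finS : finite_set S. Proof. by case: hS. Qed.

Local Notation d := (degree S : R).

Definition dirichlet f : \bar R :=
  (\sum_(s <- fset_set S) tsum (fun x => (f (x * s)%g - f x) ^+ 2)%R)%E.

(** The left-hand side is the square of a mean plus part of a variance: of
    the pairs of possible positions after one step, only those consisting of the
    present position and a neighbour are kept. *)
Lemma walk_variance f x :
  walk S f x ^+ 2 + (4 * d)^-1 * \sum_(s <- fset_set S) (f (x * s)%g - f x) ^+ 2
    <= walk S (fun y => f y ^+ 2) x.
Proof.
have d0 : 0 < d := degree_gt0 hS S0.
rewrite /walk.
set b := \sum_(s <- fset_set S) f (x * s)%g.
set c := \sum_(s <- fset_set S) f (x * s)%g ^+ 2.
have sq (a : R) : \sum_(s <- fset_set S) (f (x * s)%g - a) ^+ 2 =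
    c - 2 * a * b + d * a ^+ 2.
  under eq_bigr do rewrite sqrrB.
  rewrite big_split/= sumrB big_const_seq count_predT iter_addr_0.
  rewrite -[a ^+ 2 *+ _]mulr_natl -/d; congr (_ - _ + _).
  rewrite /b mulr_sumr; apply: eq_bigr => s _; rewrite -mulr_natr; ring.
have : 0 <= \sum_(s <- fset_set S) (f (x * s)%g - b / d) ^+ 2.
  by apply: sumr_ge0 => s _; exact: sqr_ge0.
rewrite !sq.
have -> : c - 2 * (b / d) * b + d * (b / d) ^+ 2 = c - b ^+ 2 / d.
  by field; rewrite gt_eqF.
move=> h; rewrite -subr_ge0.
have -> : 2^-1 * f x ^+ 2 + (2 * d)^-1 * c -
    ((2^-1 * f x + (2 * d)^-1 * b) ^+ 2 +
      (4 * d)^-1 * (c - 2 * f x * b + d * f x ^+ 2)) =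
    (4 * d)^-1 * (c - b ^+ 2 / d).
  by field; rewrite gt_eqF.
by rewrite mulr_ge0// invr_ge0 mulr_ge0// ltW.
Qed.

Lemma walk_energy_decay f :
  (tsum (fun x => walk S f x ^+ 2)%R + (4 * d)^-1%:E * dirichlet f <=
   tsum (fun x => f x ^+ 2)%R)%E.
Proof.
have d0 : 0 < d := degree_gt0 hS S0.
have c0 : 0 <= (4 * d)^-1 by rewrite invr_ge0 mulr_ge0// ltW.
rewrite /dirichlet -tsum_sum; last by move=> *; exact: sqr_ge0.
rewrite -tsumZ//; last by move=> x; apply: sumr_ge0 => s _; exact: sqr_ge0.
rewrite -tsumD; last 2 first.
- by move=> x; exact: sqr_ge0.
- by move=> x; rewrite mulr_ge0//; apply: sumr_ge0 => s _; exact: sqr_ge0.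
rewrite -[leRHS](tsum_walkn hS S0 1); last by move=> x; exact: sqr_ge0.
by apply: le_tsum => x; exact: walk_variance.
Qed.

(** A translation by a word is a product of translations by generators.  The
    weights 1 + 1/k and 1 + k in the induction are those for which the bound
    (k + 1)^2 comes out exactly. *)
Lemma displacement_energy f (w : seq G) : (forall s, s \in w -> S s) ->
  (tsum (fun x => (f (x * \prod_(s <- w) s)%g - f x) ^+ 2)%R <=
   ((size w)%:R ^+ 2)%:E * dirichlet f)%E.
Proof.
have E0 : (0 <= dirichlet f)%E.
  by apply: sume_ge0 => s _; apply: tsum_ge0 => x; exact: sqr_ge0.
elim: w => [_|s w IH Sw].
  rewrite expr0n/= mul0e (@eq_tsum _ _ _ (fun=> 0)).
    by rewrite /tsum esum1.
  by move=> x; rewrite big_nil mulg1 subrr expr0n.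
have {}IH := IH (fun t tw => Sw t (mem_behead (s := s :: w) tw)).
have Es : (tsum (fun x => (f (x * s)%g - f x) ^+ 2)%R <= dirichlet f)%E.
  have sS : s \in fset_set S.
    by rewrite in_fset_set// inE; apply: Sw; rewrite mem_head.
  rewrite /dirichlet (perm_big _ (perm_to_rem sS))/= big_cons leeDl//.
  by apply: sume_ge0 => t _; apply: tsum_ge0 => x; exact: sqr_ge0.
case: w => [|t w] in IH Sw *.
  rewrite expr1n mul1e; apply: le_trans Es; apply: le_tsum => x.
  by rewrite big_seq1.
set k : R := (size (t :: w))%:R in IH *.
have k0 : 0 < k by rewrite ltr0n.
have k1 : 0 <= 1 + k^-1 by rewrite addr_ge0// invr_ge0 ltW.
have k2 : 0 <= 1 + k by rewrite addr_ge0// ltW.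
set z := (\prod_(a <- t :: w) a)%g in IH *.
apply: (@le_trans _ _ ((1 + k^-1)%:E *
    tsum (fun x => (f ((x * s) * z)%g - f (x * s)%g) ^+ 2)%R +
    (1 + k)%:E * tsum (fun x => (f (x * s)%g - f x) ^+ 2)%R)%E).
  rewrite -!tsumZ//; try by move=> x; exact: sqr_ge0.
  rewrite -tsumD; try by move=> x; rewrite mulr_ge0// sqr_ge0.
  apply: le_tsum => x; rewrite big_cons -/z mulgA.
  set a := f (x * s * z)%g; set b := f (x * s)%g; set c := f x.
  rewrite -subr_ge0.
  have -> : (1 + k^-1) * (a - b) ^+ 2 + (1 + k) * (b - c) ^+ 2 - (a - c) ^+ 2 =
      k^-1 * ((a - b) - k * (b - c)) ^+ 2.
    by field; rewrite gt_eqF.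
  by rewrite mulr_ge0 ?sqr_ge0// invr_ge0 ltW.
rewrite (tsum_mulgr (fun x => (f (x * z)%g - f x) ^+ 2) s).
apply: (@le_trans _ _ ((1 + k^-1)%:E * ((k ^+ 2)%:E * dirichlet f) +
  (1 + k)%:E * dirichlet f)%E).
  by apply: leeD; apply: lee_wpmul2l => //; rewrite lee_fin.
rewrite muleA -EFinM -ge0_muleDl ?lee_fin//; last by rewrite mulr_ge0 ?sqr_ge0.
rewrite -EFinD lee_wpmul2r// lee_fin le_eqVlt; apply/orP; left; apply/eqP.
by rewrite [size _]/= -natr1 -/k; field; rewrite gt_eqF.
Qed.

(** For z in the ball of radius n, f(x)^2 is at most
    (f(xz) - f(x))^2 + 2 f(x) f(xz).  Summed over x, the first term is
    controlled by displacement_energy; averaged over z, the second one is at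
    most 2 / growth S n, because f has mass at most 1. *)
Lemma nash f (n : nat) : (1 <= growth S n)%N -> (forall x, 0 <= f x) ->
  (tsum f <= 1)%E ->
  (tsum (fun x => f x ^+ 2)%R <=
   (n%:R ^+ 2)%:E * dirichlet f + (2 / (growth S n)%:R)%:E)%E.
Proof.
set B := fset_set (word_ball S n).
rewrite /growth -/B => B1 f0 f1.
set V : R := (#|`B|)%:R.
have V0 : 0 < V by rewrite ltr0n.
have finB : finite_set (word_ball S n).
  apply: contrapT => h; move: B1; rewrite /B /fset_set.
  by case: pselect => // _; rewrite cardfs0.
have {}Sball z : z \in B -> exists2 w, (forall s, s \in w -> S s) &
    (size w <= n)%N /\ z = (\prod_(s <- w) s)%g.
  by rewrite in_fset_set// inE => -[w [wn Sw ->]]; exists w.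
have E0 : (0 <= dirichlet f)%E.
  by apply: sume_ge0 => s _; apply: tsum_ge0 => x; exact: sqr_ge0.
have fB0 x : 0 <= \sum_(z <- B) f (x * z)%g by exact: sumr_ge0.
have fB x : \sum_(z <- B) f (x * z)%g <= 1.
  rewrite -lee_fin; apply: le_trans f1.
  by rewrite -(tsum_mulgl f x); exact: finsum_le_tsum.
have main : (V%:E * tsum (fun x => f x ^+ 2)%R <=
    V%:E * ((n%:R ^+ 2)%:E * dirichlet f) + 2%:E)%E.
  apply: (@le_trans _ _ (\sum_(z <- B) tsum (fun x => (f (x * z)%g - f x) ^+ 2)%R
      + 2%:E * tsum f)%E); last first.
    apply: leeD; last by rewrite -[leRHS]mule1 lee_wpmul2l// lee_fin.
    rewrite big_seq; apply: (@le_trans _ _ (\sum_(z <- B | z \in B)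
        ((n%:R ^+ 2)%:E * dirichlet f))%E).
      apply: lee_sum => z /Sball[w Sw [wn ->]].
      apply: (le_trans (displacement_energy f Sw)).
      rewrite lee_wpmul2r// lee_fin ler_pXn2r ?nnegrE ?ler0n//.
      by rewrite ler_nat.
    by rewrite -big_seq sume_cst// mule_ge0// lee_fin sqr_ge0.
  rewrite -tsum_sum; last by move=> *; exact: sqr_ge0.
  rewrite -!tsumZ//; last by move=> x; exact: sqr_ge0.
  rewrite -tsumD; last 2 first.
  - by move=> x; apply: sumr_ge0 => z _; exact: sqr_ge0.
  - by move=> x; rewrite mulr_ge0.
  apply: le_tsum => x.
  apply: (@le_trans _ _ (\sum_(z <- B) ((f (x * z)%g - f x) ^+ 2 +
      2 * f x * f (x * z)%g))).
    rewrite /V -[#|`B|]count_predT mulr_natl -iter_addr_0 -big_const_seq.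
    apply: ler_sum => z _; rewrite -subr_ge0.
    have -> : (f (x * z)%g - f x) ^+ 2 + 2 * f x * f (x * z)%g - f x ^+ 2 =
      f (x * z)%g ^+ 2 by ring.
    exact: sqr_ge0.
  rewrite big_split/= lerD2l -mulr_sumr -[leRHS]mulr1 ler_wpM2l//.
  by rewrite mulr_ge0.
rewrite -(@lee_pmul2l _ V%:E)//.
rewrite muleDr//; last first.
  by rewrite fin_num_adde_defl.
by rewrite -EFinM mulrC divfK ?gt_eqF.
Qed.

End HeatDecay.

(** * From the Nash inequality to polynomial decay *)

Section DecayRecursion.
Context {R : realType}.

(** With A n > C (n+2)^(-N/2), a radius r of order sqrt(n+2) makes the
    volume term at most A n / 2, so one step multiplies A by at most
    1 - (N/2) / (n+2), which Bernoulli's inequality bounds by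
    ((n+1) / (n+2))^(N/2).  For small n there is no admissible radius, and the
    trivial bound A <= 1 is used. *)
Lemma decay_of_nash_recursion (N : nat) (d C1 : R) : (2 <= N)%N -> 1 <= d -> 0 < C1 ->
  exists2 C, 0 < C & forall A : nat -> R,
    (forall n, A n <= 1) -> (forall n, A n.+1 <= A n) ->
    (forall n r, (0 < r)%N ->
      A n.+1 <= A n - (4 * d * r%:R ^+ 2)^-1 * (A n - 2 / (C1 * r%:R ^+ N))) ->
    forall n, A n <= C * n.+1%:R `^ (- (N%:R / 2)).
Proof.
move=> N2 d1 C10.
have d0 : 0 < d by apply: lt_le_trans d1.
have Npos : (0 < N)%N by apply: leq_trans N2.
have N0 : 0 < N%:R :> R by rewrite ltr0n; apply: leq_trans N2.
pose b : R := N%:R / 2.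
have b1 : 1 <= b by rewrite /b ler_pdivlMr// mul1r ler_nat.
have b0 : 0 < b by apply: lt_le_trans b1.
have e0 : 0 < 8 * d * b by rewrite !mulr_gt0.
pose eta := Num.sqrt (8 * d * b)^-1.
have eta0 : 0 < eta by rewrite sqrtr_gt0 invr_gt0.
have eta1 : eta <= 1.
  rewrite -sqrtr1 ler_wsqrtr// invf_le1//.
  have : 1 <= d * b by rewrite -[1]mulr1; apply: ler_pM.
  lra.
(* 4 / C1 absorbs the volume term, and the summand 1 the initial times *)
pose C := (4 / C1 + 1) * (2 / eta) ^+ N.
have c1 : 1 <= 4 / C1 + 1 by rewrite lerDr divr_ge0// ltW.
have einv : 1 <= eta^-1 by rewrite invf_ge1.
have pe1 : eta^-1 ^+ N <= C.
  rewrite -[leLHS]mul1r; apply: ler_pM => //.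
    by rewrite exprn_ge0// invr_ge0 ltW.
  rewrite ler_pXn2r// ?nnegrE ?divr_ge0 ?invr_ge0 ?(ltW eta0)//.
  by rewrite ler_peMl// ?invr_ge0 ?(ltW eta0)// ler1n.
have C1' : 1 <= C by apply: le_trans pe1; apply: exprn_ege1.
have C0 : 0 < C by apply: lt_le_trans C1'.
exists C => // A A1 Amono Arec.
(* sqrt carries the half-integer exponent N / 2 *)
have sqrtN (x : R) : 0 <= x -> Num.sqrt x ^+ N = x `^ b.
  move=> x0; rewrite -powR12_sqrt// -powR_mulrn ?powR_ge0// -powRrM.
  by rewrite /b mulrC.
elim=> [|n IH]; first by rewrite powR1 mulr1; apply: le_trans C1'.
rewrite -/b in IH *.
set m : R := n.+2%:R.
have m0 : 0 < m by rewrite ltr0n.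
(* the largest radius for which (8 d r^2)^-1 >= b / m *)
pose x := eta * Num.sqrt m.
have x0 : 0 < x by rewrite mulr_gt0// sqrtr_gt0.
have [x1|x1] := ltP x 1.
  apply: (le_trans (A1 _)); rewrite powRN ler_pdivlMr ?powR_gt0// mul1r.
  rewrite -sqrtN ?(ltW m0)//; apply: le_trans pe1.
  rewrite ler_pXn2r// ?nnegrE ?invr_ge0 ?sqrtr_ge0 ?(ltW eta0)//.
  rewrite -[leRHS]mulr1 ler_pdivlMl//; exact: ltW.
have [An|An] := leP (A n) (C * m `^ (- b)).
  exact: (le_trans (Amono n) An).
pose r := Num.truncn x.
have /andP[rx xr] : r%:R <= x < r.+1%:R by apply: truncn_itv; exact: ltW.
have r0 : (0 < r)%N by rewrite truncn_gt_nat.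
have r1 : 1 <= r%:R :> R by rewrite ler1n.
have rP : 0 < r%:R :> R by rewrite ltr0n.
have xr2 : x / 2 <= r%:R.
  rewrite ler_pdivrMr//; apply: ltW (lt_le_trans xr _).
  by rewrite -natr1 mulr2n mulrDr mulr1 lerD2l.
have mb0 : 0 < m `^ b by rewrite powR_gt0.
have volume : 2 / (C1 * r%:R ^+ N) <= C * m `^ (- b) / 2.
  have low : (eta / 2) ^+ N * m `^ b <= r%:R ^+ N.
    rewrite -sqrtN ?(ltW m0)// -exprMn mulrAC -/x.
    by rewrite ler_pXn2r// nnegrE ?divr_ge0 ?(ltW x0)// ltW.
  have q0 : 0 < (eta / 2) ^+ N by rewrite exprn_gt0// divr_gt0.
  have -> : C * m `^ (- b) / 2 = (4 / C1 + 1) / 2 / ((eta / 2) ^+ N * m `^ b).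
    rewrite powRN /C -[2 / eta]invf_div exprVn.
    by field; rewrite !gt_eqF.
  rewrite ler_pdivrMr; last by rewrite mulr_gt0// exprn_gt0.
  rewrite mulrAC ler_pdivlMr ?mulr_gt0//.
  apply: (@le_trans _ _ ((4 / C1 + 1) / 2 * (C1 * ((eta / 2) ^+ N * m `^ b)))).
    rewrite [leRHS]mulrA ler_wpM2r ?mulr_ge0 ?(ltW q0) ?(ltW mb0)//.
    have -> : (4 / C1 + 1) / 2 * C1 = 2 + C1 / 2 by field; rewrite gt_eqF.
    by rewrite lerDl divr_ge0// ltW.
  apply: ler_wpM2l; first by rewrite divr_ge0// (le_trans ler01).
  by rewrite ler_pM2l.
have scale : b / m <= (8 * d * r%:R ^+ 2)^-1.
  rewrite -[b / m]invf_div lef_pV2 ?posrE ?divr_gt0 ?mulr_gt0 ?exprn_gt0//.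
  rewrite ler_pdivlMr//.
  have : r%:R ^+ 2 <= (8 * d * b)^-1 * m.
    rewrite -[X in X * m]sqr_sqrtr ?invr_ge0 ?(ltW e0)//.
    rewrite -[X in _ * X](sqr_sqrtr (ltW m0)) -exprMn -/x.
    by rewrite ler_pXn2r// nnegrE ltW.
  rewrite mulrC ler_pdivlMr// => h; apply: le_trans h.
  by rewrite le_eqVlt; apply/orP; left; apply/eqP; ring.
have A0 : 0 <= A n by apply: le_trans (ltW An); rewrite mulr_ge0 ?powR_ge0 ?(ltW C0).
apply: (@le_trans _ _ (A n * (1 - b / m))).
  apply: (le_trans (Arec n r r0)).
  have h : A n / 2 <= A n - 2 / (C1 * r%:R ^+ N).
    have : 2 / (C1 * r%:R ^+ N) <= A n / 2.
      by apply: (le_trans volume); rewrite ler_pM2r ?invr_gt0// ltW.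
    by move: (2 / (C1 * r%:R ^+ N)) => y; lra.
  apply: (@le_trans _ _ (A n - (4 * d * r%:R ^+ 2)^-1 * (A n / 2))).
    by rewrite lerD2l lerN2 ler_wpM2l// invr_ge0 !mulr_ge0 ?sqr_ge0// ltW.
  rewrite mulrBr mulr1 lerD2l lerN2.
  have -> : (4 * d * r%:R ^+ 2)^-1 * (A n / 2) = A n * (8 * d * r%:R ^+ 2)^-1.
    by field; rewrite !gt_eqF.
  by rewrite ler_wpM2l.
have t1 : 0 <= 1 - m^-1 by rewrite subr_ge0 invf_le1// ler1n.
apply: (@le_trans _ _ (A n * (1 - m^-1) `^ b)).
  rewrite ler_wpM2l//.
  have := powR_tangent b1 (@ler01 R) t1.
  rewrite !powR1 !mulr1 mulrBr mulr1.
  by move: (b / m) => y; lra.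
apply: (@le_trans _ _ (C * n.+1%:R `^ (- b) * (1 - m^-1) `^ b)).
  by rewrite ler_wpM2r// powR_ge0.
have -> : 1 - m^-1 = n.+1%:R / m.
  by rewrite -[X in _ = X / _](@addrK _ 1 n.+1%:R) natr1 -/m mulrBl mulfV ?gt_eqF// mul1r.
rewrite powRM ?invr_ge0 ?ler0n// powRV mulrA -(mulrA C) -powRD ?addNr.
  by rewrite powRr0 mulr1.
by rewrite pnatr_eq0/= implybT.
Qed.
End DecayRecursion.

(** * Decay of the heat kernel *)

Section HeatKernel.
Context {R : realType} {G : groupType} (S : set G).
Implicit Types (f g u : G -> R) (x y : G).

Hypothesis hS : cayley_generators S.
Hypothesis S0 : S !=set0.

Local Notation walkn := (walkn (R := R) S).

Definition point_mass x : G -> R := fun y => (y == x)%:R.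

Lemma point_mass_ge0 x y : 0 <= point_mass x y.
Proof. exact: ler0n. Qed.

Lemma tsum_point_mass_mul x f : (forall y, 0 <= f y) ->
  tsum (fun y => point_mass x y * f y) = (f x)%:E.
Proof.
move=> f0; rewrite /tsum -(@esum_set1 _ _ x (fun y => (f y)%:E)) ?lee_fin//.
rewrite [RHS]esum_mkcond; apply: eq_esum => y _.
have [->|yx] := eqVneq y x.
  by rewrite /point_mass eqxx mul1r ifT// inE.
rewrite /point_mass (negbTE yx) mul0r ifF//.
by apply/negbTE; apply: contra yx; rewrite inE => /= ->.
Qed.

Lemma tsum_point_mass x : tsum (point_mass x) = 1%E.
Proof.
rewrite -[RHS](tsum_point_mass_mul x (f := fun=> 1))//.
by apply: eq_tsum => y; rewrite mulr1.
Qed.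

(** By reversibility this is the probability that the walk started at x is
    back at x after 2n steps. *)
Definition return_probability n x : R := fine (tsum (fun y => walkn n (point_mass x) y ^+ 2)).

Lemma walkn_point_mass_ge0 n x y : 0 <= walkn n (point_mass x) y.
Proof. by apply: walkn_ge0 => // z; exact: point_mass_ge0. Qed.

Lemma walkn_point_mass_le1 n x y : walkn n (point_mass x) y <= 1.
Proof.
rewrite -lee_fin; apply: (le_trans (term_le_tsum _ _)).
by rewrite tsum_walkn ?tsum_point_mass// => z; exact: point_mass_ge0.
Qed.

Lemma tsum_sqr_walkn_point_mass_le1 n x :
  (tsum (fun y => walkn n (point_mass x) y ^+ 2)%R <= 1)%E.
Proof.
rewrite -(tsum_point_mass x) -[leRHS](tsum_walkn hS S0 n); last exact: point_mass_ge0.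
apply: le_tsum => y; rewrite expr2 -[leRHS]mul1r ler_wpM2r//.
  exact: walkn_point_mass_ge0.
exact: walkn_point_mass_le1.
Qed.

Lemma return_probabilityE n x : tsum (fun y => walkn n (point_mass x) y ^+ 2) = (return_probability n x)%:E.
Proof.
rewrite /return_probability -tsum_fineK//; first by move=> y; exact: sqr_ge0.
exact: le_lt_trans (tsum_sqr_walkn_point_mass_le1 n x) (ltry _).
Qed.

Lemma return_probability_decay (N : nat) : (2 <= N)%N -> polynomial_growth R S N ->
  exists2 C, 0 < C & forall n x, return_probability n x <= C * n.+1%:R `^ (- (N%:R / 2)).
Proof.
move=> N2 [C1 [C2 [C10 _ hV]]].
have d0 : 0 < degree S :> R by exact: degree_gt0.
have d1 : 1 <= degree S :> R.
  by move: d0; rewrite /degree ltr0n ler1n.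
have [C C0 hC] := decay_of_nash_recursion N2 d1 C10.
exists C => // n x; apply: (hC (fun n => return_probability n x)) => {n} [n|n|n r r0].
- by rewrite -lee_fin -return_probabilityE tsum_sqr_walkn_point_mass_le1.
- rewrite -lee_fin -!return_probabilityE.
  apply: le_trans (walk_energy_decay hS S0 (walkn n (point_mass x))).
  rewrite leeDl// mule_ge0//.
    by rewrite lee_fin invr_ge0 mulr_ge0// ltW.
  by apply: sume_ge0 => s _; apply: tsum_ge0 => y; exact: sqr_ge0.
have /andP[Vr _] := hV r r0.
have rN0 : 0 < C1 * r%:R ^+ N by rewrite mulr_gt0// exprn_gt0// ltr0n.
have V0 : 0 < (growth S r)%:R :> R by apply: lt_le_trans Vr.
have V1 : (1 <= growth S r)%N by rewrite -(ltr0n R).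
have := nash hS V1 (walkn_point_mass_ge0 n x).
rewrite tsum_walkn ?tsum_point_mass//.
move=> /(_ (lexx _)); rewrite return_probabilityE => hN.
have hE : ((return_probability n.+1 x)%:E + (4 * degree S)^-1%:E *
    dirichlet S (walkn n (point_mass x)) <= (return_probability n x)%:E)%E.
  by rewrite -!return_probabilityE; exact: walk_energy_decay.
have rr0 : 0 < r%:R ^+ 2 :> R by rewrite exprn_gt0// ltr0n.
have E0 : (0 <= dirichlet S (walkn n (point_mass x)))%E.
  by apply: sume_ge0 => s _; apply: tsum_ge0 => y; exact: sqr_ge0.
have Efin : dirichlet S (walkn n (point_mass x)) \is a fin_num.
  rewrite ge0_fin_numE// ltey; apply/negP => /eqP Eoo.
  by move: hE; rewrite Eoo gt0_muley ?lte_fin ?invr_gt0 ?mulr_gt0.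
move: hE hN; rewrite -(fineK Efin); set E := fine _.
rewrite -!EFinM -!EFinD !lee_fin => hE hN.
have h : return_probability n x - 2 / (C1 * r%:R ^+ N) <= r%:R ^+ 2 * E.
  rewrite lerBlDr; apply: (le_trans hN); rewrite lerD2l.
  by rewrite ler_pM2l// lef_pV2.
have c0 : 0 < (4 * degree S * r%:R ^+ 2)^-1 :> R.
  by rewrite invr_gt0 mulr_gt0// mulr_gt0.
move: h; rewrite -(ler_pM2l c0) [X in _ <= X -> _](_ : _ = (4 * degree S)^-1 * E).
  by move: (_ * (_ - _)) ((4 * _)^-1 * E) hE => a b; lra.
by field; rewrite !gt_eqF//; move: r0; rewrite -(ltr0n R).
Qed.

(** Ultracontractivity: the semigroup maps l^1 to l^oo with norm at most
    C n^(-N/2). *)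
Definition heat_decay (N : nat) (C : R) : Prop :=
  forall n f x, (forall y, 0 <= f y) ->
    ((walkn n f x)%:E <= (C * n.+1%:R `^ (- (N%:R / 2)))%:E * tsum f)%E.

(** The kernel of P^(2k) is an inner product of two rows of P^k, hence is
    bounded by the diagonal values. *)
Theorem heat_bound (N : nat) : (2 <= N)%N -> polynomial_growth R S N ->
  exists2 C, 0 < C & heat_decay N C.
Proof.
move=> N2 hV; have [C C0 hC] := return_probability_decay N2 hV.
pose b : R := N%:R / 2; have b0 : 0 <= b by rewrite divr_ge0.
have kernel k x y : walkn k (walkn k (point_mass x)) y <= C * k.+1%:R `^ (- b).
  have [hx hy] := (hC k x, hC k y).
  have px z : 0 <= walkn k (point_mass x) z := walkn_point_mass_ge0 k x z.
  have py z : 0 <= walkn k (point_mass y) z := walkn_point_mass_ge0 k y z.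
  rewrite -lee_fin -(tsum_point_mass_mul y); last by apply: walkn_ge0.
  rewrite tsum_walkn_dual//.
  apply: (@le_trans _ _ (tsum (fun z => 2^-1 * walkn k (point_mass y) z ^+ 2 +
      2^-1 * walkn k (point_mass x) z ^+ 2))).
    apply: le_tsum => z; rewrite -subr_ge0.
    set a := walkn k _ z; set c := walkn k _ z.
    have -> : 2^-1 * a ^+ 2 + 2^-1 * c ^+ 2 - a * c = 2^-1 * (a - c) ^+ 2 by field.
    by rewrite mulr_ge0// sqr_ge0.
  rewrite tsumD; try by move=> z; rewrite mulr_ge0// sqr_ge0.
  rewrite !tsumZ//; try by move=> z; rewrite sqr_ge0.
  rewrite !return_probabilityE -!EFinM -EFinD lee_fin.
  by move: hx hy; rewrite -/b; move: (C * _) => c; lra.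
have even k f x : (forall y, 0 <= f y) ->
    ((walkn k (walkn k f) x)%:E <= (C * k.+1%:R `^ (- b))%:E * tsum f)%E.
  move=> f0; have g0 y : 0 <= walkn k f y by apply: walkn_ge0.
  rewrite -(tsum_point_mass_mul x); last by apply: walkn_ge0.
  rewrite tsum_walkn_dual//.
  rewrite tsum_walkn_dual//; last exact: walkn_point_mass_ge0.
  rewrite -tsumZ//; last by rewrite mulr_ge0 ?powR_ge0// ltW.
  by apply: le_tsum => y; rewrite ler_wpM2r.
exists (C * 2 `^ b); first by rewrite mulr_gt0// powR_gt0.
move=> n f x f0.
have -> : walkn n f x = walkn n./2 (walkn n./2 (walkn (odd n) f)) x.
  by rewrite /walkn -!iterD addnn addnC odd_double_half.
apply: (le_trans (even n./2 _ x _)); first by apply: walkn_ge0.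
rewrite tsum_walkn// lee_wpmul2r ?tsum_ge0// lee_fin -mulrA ler_pM2l//.
rewrite -/b -!powRV -powRM ?invr_ge0//.
apply: ler_powR_base; rewrite ?invr_ge0//.
rewrite ler_pdivlMr// ler_pdivrMl// -natrM ler_nat.
rewrite muln2 doubleS -[X in (X < _)%N]odd_double_half ltnS -add1n leq_add2r.
by case: odd.
Qed.

End HeatKernel.

(** * The Green operator *)

Section Green.
Context {R : realType} {G : groupType} (S : set G) (N : nat) (C : R).
Implicit Types (f g u : G -> R) (x y : G).

Hypothesis hS : cayley_generators S.
Hypothesis S0 : S !=set0.
Hypothesis C0 : 0 < C.
Hypothesis heat : heat_decay S N C.

Local Notation walkn := (walkn (R := R) S).
Local Notation c := ((2 * degree S)^-1 : R).

Definition green_series f x := tsum (fun n => c * walkn n f x).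

(** The operator (- Delta)^-1, since Delta = 2 degree (P - 1). *)
Definition green f x : R := fine (green_series f x).

Definition green_finite f : Prop := forall x, (green_series f x < +oo)%E.

Let c0 : 0 < c.
Proof. by rewrite invr_gt0 mulr_gt0// degree_gt0. Qed.

Lemma green_term_ge0 f x n : (forall y, 0 <= f y) -> 0 <= c * walkn n f x.
Proof. by move=> f0; rewrite mulr_ge0 ?(ltW c0)//; apply: walkn_ge0. Qed.

Lemma green_ge0 f x : (forall y, 0 <= f y) -> 0 <= green f x.
Proof.
by move=> f0; apply/fine_ge0/tsum_ge0 => n; exact: green_term_ge0.
Qed.

Lemma green_seriesE f x : (forall y, 0 <= f y) -> green_finite f ->
  green_series f x = (green f x)%:E.
Proof.
by move=> f0 fin; apply: tsum_fineK => [n|]; [exact: green_term_ge0|exact: fin].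
Qed.

Lemma green_ge_sum f x n : (forall y, 0 <= f y) -> green_finite f ->
  \sum_(0 <= k < n) c * walkn k f x <= green f x.
Proof.
move=> f0 fin; rewrite -lee_fin -green_seriesE//.
by apply: sum_nat_le_tsum => k; exact: green_term_ge0.
Qed.

Lemma green_dual f g : (forall x, 0 <= f x) -> (forall x, 0 <= g x) ->
  green_finite f -> green_finite g ->
  tsum (fun x => f x * green g x) = tsum (fun x => green f x * g x).
Proof.
move=> f0 g0 ff gf.
have expand u v : (forall x, 0 <= u x) -> (forall x, 0 <= v x) -> green_finite v ->
    tsum (fun x => u x * green v x) =
    (\esum_(n in [set: nat]) tsum (fun x => (u x * (c * walkn n v x))%R))%E.
  move=> u0 v0 vf; rewrite [RHS]esum_swap; last first.
    by move=> n x; rewrite lee_fin mulr_ge0// green_term_ge0.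
  apply: eq_esum => x _; rewrite -/(tsum _) tsumZ//.
    by rewrite -/(green_series v x) green_seriesE.
  by move=> n; exact: green_term_ge0.
have -> : tsum (fun x => green f x * g x) = tsum (fun x => g x * green f x).
  by apply: eq_tsum => x; rewrite mulrC.
rewrite !expand//.
apply: eq_esum => n _.
have -> : tsum (fun x => f x * (c * walkn n g x)) =
    (c%:E * tsum (fun x => f x * walkn n g x)%R)%E.
  rewrite -tsumZ ?(ltW c0)//.
    by apply: eq_tsum => x; rewrite mulrCA.
  by move=> x; rewrite mulr_ge0//; apply: walkn_ge0.
have -> : tsum (fun x => g x * (c * walkn n f x)) =
    (c%:E * tsum (fun x => g x * walkn n f x)%R)%E.
  rewrite -tsumZ ?(ltW c0)//.
    by apply: eq_tsum => x; rewrite mulrCA.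
  by move=> x; rewrite mulr_ge0//; apply: walkn_ge0.
rewrite tsum_walkn_dual//; congr (_ * _)%E.
by apply: eq_tsum => x; rewrite mulrC.
Qed.

(** Splitting off the term n = 0 of the series. *)
Lemma green_fixpoint f x : (forall y, 0 <= f y) -> green_finite f ->
  green f x = c * f x + walk S (green f) x.
Proof.
move=> f0 fin; apply: EFin_inj; rewrite -green_seriesE// /green_series.
rewrite tsum_nat_recl; last by move=> n; exact: green_term_ge0.
rewrite EFinD; congr (_ + _)%E.
have t0 z n : 0 <= c * walkn n f z by exact: green_term_ge0.
rewrite /walk EFinD !EFinM -sumEFin.
under eq_bigr do rewrite -green_seriesE//.
rewrite -green_seriesE// /green_series -tsum_sum//.
rewrite -!tsumZ ?(ltW c0)//; last by move=> n; apply: sumr_ge0 => s _.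
rewrite -tsumD; last 2 first.
- by move=> n; rewrite mulr_ge0.
- by move=> n; rewrite mulr_ge0 ?(ltW c0)//; apply: sumr_ge0 => s _.
apply: eq_tsum => n; rewrite -mulr_sumr.
have -> : walkn n.+1 f x = walk S (walkn n f) x by [].
by rewrite /walk; ring.
Qed.

Lemma laplacian_green f x : (forall y, 0 <= f y) -> green_finite f ->
  laplacian S (green f) x = - f x.
Proof.
move=> f0 fin; rewrite laplacian_walk// [X in _ - X]green_fixpoint//.
by field; rewrite gt_eqF// degree_gt0.
Qed.

Lemma green_translate (z : G) f x :
  green (fun y => f (z * y)%g) x = green f (z * x)%g.
Proof.
by congr fine; apply: eq_tsum => n; rewrite walkn_translate.
Qed.

Lemma green_finite_le f g : (forall x, f x <= g x) -> green_finite g -> green_finite f.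
Proof.
move=> fg gf x; apply: le_lt_trans (gf x); apply: le_tsum => n.
by rewrite ler_pM2l//; apply: le_walkn.
Qed.

Lemma greenZ a f x : 0 <= a -> (forall y, 0 <= f y) -> green_finite f ->
  green (fun y => a * f y) x = a * green f x.
Proof.
move=> a0 f0 fin; rewrite /green /green_series.
rewrite (@eq_tsum _ _ _ (fun n => a * (c * walkn n f x))); last first.
  move=> n; have := walkn_lin S n a 0 f f x.
  rewrite mul0r addr0 mulrCA => <-; congr (_ * walkn _ _ _).
  by apply/funext => y; rewrite mul0r addr0.
rewrite (tsumZ a0); last by move=> n; exact: green_term_ge0.
by rewrite -/(green_series f x) green_seriesE.
Qed.

Section Bounds.
Variables (p : R).
Hypothesis p1 : 1 <= p.

Let p0 : 0 < p. Proof. exact: lt_le_trans p1. Qed.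

(** Interpolation between l^1 -> l^oo and l^oo -> l^oo, by Jensen. *)
Lemma walkn_sup_bound f A n x : 0 <= A -> (forall y, 0 <= f y) ->
  (tsum (fun y => f y `^ p)%R <= (A `^ p)%:E)%E ->
  walkn n f x <= C `^ p^-1 * A * n.+1%:R `^ (- (N%:R / 2 / p)).
Proof.
move=> A0 f0 fA.
have C0' := ltW C0.
have w0 : 0 <= walkn n f x by apply: walkn_ge0.
have n0 : 0 <= n.+1%:R `^ (- (N%:R / 2)) :> R by exact: powR_ge0.
rewrite -[leLHS](powRK w0 (lt0r_neq0 p0)).
have h : walkn n f x `^ p <= C * n.+1%:R `^ (- (N%:R / 2)) * A `^ p.
  rewrite -lee_fin; apply: le_trans (_ : (walkn n (fun y => f y `^ p) x)%:E <= _)%E.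
    by rewrite lee_fin walkn_jensen.
  apply: (le_trans (heat _ _ _)); first by move=> y; exact: powR_ge0.
  by rewrite [leRHS]EFinM lee_wpmul2l// lee_fin mulr_ge0.
apply: (le_trans (ler_powR_base _ _ h)); rewrite ?invr_ge0 ?powR_ge0 ?(ltW p0)//.
rewrite !powRM ?mulr_ge0 ?powR_ge0// powRK ?gt_eqF//.
by rewrite -powRrM mulNr -/(N%:R / 2 / p) mulrAC.
Qed.

Lemma tsum_walkn_powR f A n : (forall y, 0 <= f y) ->
  (tsum (fun y => f y `^ p)%R <= A)%E ->
  (tsum (fun y => walkn n f y `^ p)%R <= A)%E.
Proof.
move=> f0; apply: le_trans.
rewrite -[leRHS](tsum_walkn hS S0 n); last by move=> y; exact: powR_ge0.
by apply: le_tsum => y; apply: walkn_jensen.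
Qed.

Section Pointwise.
Hypothesis pN : 2 * p < N%:R.

Let a : R := N%:R / 2 / p - 1.
Let a0 : 0 < a.
Proof. by rewrite subr_gt0 ltr_pdivlMr// ltr_pdivlMr// mul1r mulrC. Qed.

Definition tail_const : R := c * C `^ p^-1 / a.

Lemma tail_const_ge0 : 0 <= tail_const.
Proof. by rewrite /tail_const divr_ge0 ?(ltW a0)// mulr_ge0 ?powR_ge0 ?(ltW c0). Qed.

Lemma green_series_tail f A M x : 0 <= A -> (forall y, 0 <= f y) ->
  (tsum (fun y => f y `^ p)%R <= (A `^ p)%:E)%E ->
  (green_series f x <= (\sum_(0 <= k < M.+1) c * walkn k f x +
     tail_const * A * M.+1%:R `^ (- a))%:E)%E.
Proof.
move=> A0 f0 fA; apply: tsum_nat_le => [n|n]; first exact: green_term_ge0.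
have t0 k : 0 <= c * walkn k f x by exact: green_term_ge0.
have T0 : 0 <= tail_const * A * M.+1%:R `^ (- a).
  by rewrite mulr_ge0 ?powR_ge0// mulr_ge0// tail_const_ge0.
have [nM|Mn] := leqP n M.+1.
  rewrite [leRHS]addrC ler_wpDl//.
  rewrite [leRHS](big_cat_nat (n := n))//= lerDl.
  by apply: sumr_ge0 => k _.
rewrite (big_cat_nat (n := M.+1))//= ?(ltnW Mn)// lerD2l.
rewrite -(subnKC (ltnW Mn)).
apply: (@le_trans _ _ (\sum_(M.+1 <= k < M.+1 + (n - M.+1))
    c * C `^ p^-1 * A * k.+1%:R `^ (- (a + 1)))).
  apply: ler_sum => k _; rewrite -!mulrA ler_pM2l// !mulrA.
  by have := walkn_sup_bound k x A0 f0 fA; rewrite /a subrK.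
rewrite -mulr_sumr; apply: (le_trans (ler_wpM2l _ (sum_riemann_tail M (n - M.+1) a0))).
  by rewrite !mulr_ge0 ?powR_ge0 ?(ltW c0).
by rewrite le_eqVlt; apply/orP; left; apply/eqP; rewrite /tail_const; ring.
Qed.

Lemma green_finite_lp f A : 0 <= A -> (forall y, 0 <= f y) ->
  (tsum (fun y => f y `^ p)%R <= (A `^ p)%:E)%E -> green_finite f.
Proof.
move=> A0 f0 fA x.
exact: le_lt_trans (green_series_tail 0 x A0 f0 fA) (ltry _).
Qed.

(** The truncation error is uniform in x and over bounded sets of l^p, so K
    is a uniform limit of local operators; green_cvg depends on this. *)
Lemma green_tail f A M x : 0 <= A -> (forall y, 0 <= f y) ->
  (tsum (fun y => f y `^ p)%R <= (A `^ p)%:E)%E ->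
  green f x <= \sum_(0 <= k < M.+1) c * walkn k f x +
     tail_const * A * M.+1%:R `^ (- a).
Proof.
move=> A0 f0 fA; rewrite -lee_fin -green_seriesE//; first exact: green_series_tail.
exact: green_finite_lp fA.
Qed.

End Pointwise.
End Bounds.
End Green.

(** * The Sobolev inequality for the Green operator *)

Section GreenSobolev.
Context {R : realType} {G : groupType} (S : set G) (N : nat) (C : R).
Implicit Types (f g u : G -> R) (x y : G).

Hypothesis hS : cayley_generators S.
Hypothesis S0 : S !=set0.
Hypothesis C0 : 0 < C.
Hypothesis heat : heat_decay S N C.

Local Notation walkn := (walkn (R := R) S).
Local Notation c := ((2 * degree S)^-1 : R).

Variables p r : R.
Hypothesis N0 : (0 < N)%N.
Hypothesis p1 : 1 <= p.
Hypothesis r0 : 0 < r.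
Hypothesis gain : 2 / N%:R < p^-1 - r^-1.

Let NR : 0 < N%:R :> R. Proof. by rewrite ltr0n. Qed.
Let p0 : 0 < p. Proof. exact: lt_le_trans p1. Qed.

Lemma gain_lt : p < r.
Proof.
rewrite -[p]invrK -[r]invrK ltf_pV2 ?posrE ?invr_gt0//.
by rewrite -subr_gt0 (lt_trans _ gain)// divr_gt0.
Qed.

Lemma gain_pointwise : 2 * p < N%:R.
Proof.
have h : 2 / N%:R < p^-1 by apply: (lt_trans gain); rewrite gtrBl invr_gt0.
by move: h; rewrite ltr_pdivrMr// mulrC ltr_pdivlMr.
Qed.

Let eps : R := N%:R / 2 * (p^-1 - r^-1) - 1.
Let eps0 : 0 < eps.
Proof.
rewrite subr_gt0 -ltr_pdivrMl ?divr_gt0// mulr1 invf_div; exact: gain.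
Qed.

Let Z : R := 1 + eps^-1.
Let Z0 : 0 < Z. Proof. by rewrite addr_gt0 ?invr_gt0. Qed.

Let weight_sum : (tsum (fun n : nat => (n.+1%:R `^ (- (eps + 1)))%R) <= Z%:E)%E.
Proof.
apply: tsum_nat_le => [n|[|n]]; first exact: powR_ge0.
  by rewrite big_geq// ltW.
rewrite big_nat_recl//= powR1 lerD2l -[leRHS]mulr1.
have := sum_riemann_tail 0 n eps0; rewrite powR1 add1n; apply: le_trans.
by rewrite big_add1.
Qed.

Definition sobolev_const : R := c * C `^ (p^-1 - r^-1) * Z.

Lemma sobolev_const_gt0 : 0 < sobolev_const.
Proof.
by rewrite !mulr_gt0 ?powR_gt0 ?invr_gt0// mulr_gt0// degree_gt0.
Qed.

(** By walkn_sup_bound the l^r norm of P^n f is at most of order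
    n^(-(N/2)(1/p - 1/r)).  The exponent exceeds 1 by eps, so the norms are
    summable; tsum_jensen with weights proportional to (n+1)^(-(1+eps)) sums the
    functions. *)
Lemma green_sobolev f A : 0 <= A -> (forall y, 0 <= f y) ->
  (tsum (fun y => f y `^ p)%R <= (A `^ p)%:E)%E ->
  (tsum (fun y => green S f y `^ r)%R <= ((sobolev_const * A) `^ r)%:E)%E.
Proof.
move=> A0 f0 fA.
have c0 : 0 < c by rewrite invr_gt0 mulr_gt0// degree_gt0.
have pr := gain_lt.
have r1 : 1 <= r by apply: le_trans p1 _; exact: ltW.
have fin : green_finite S f.
  exact: (green_finite_lp hS S0 C0 heat p1 gain_pointwise A0 f0 fA).
pose w (n : nat) : R := n.+1%:R `^ (- (eps + 1)) / Z.
have w0 n : 0 < w n by rewrite divr_gt0// powR_gt0.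
have w1 : (tsum w <= 1)%E.
  rewrite (@eq_tsum _ _ _ (fun n => Z^-1 * n.+1%:R `^ (- (eps + 1)))); last first.
    by move=> n; rewrite mulrC.
  rewrite tsumZ ?invr_ge0 ?(ltW Z0)//.
  apply: (le_trans (lee_wpmul2l _ weight_sum)); rewrite ?lee_fin ?invr_ge0 ?(ltW Z0)//.
  by rewrite mulVf ?gt_eqF.
pose a n y := c * walkn n f y.
have a0 n y : 0 <= a n y by exact: green_term_ge0.
have point y : ((green S f y `^ r)%:E <=
    tsum (fun n => w n `^ (1 - r) * a n y `^ r)%R)%E.
  apply: tsum_jensen => //; first exact: green_ge0.
  by rewrite -green_seriesE.
apply: (@le_trans _ _ (\esum_(y in [set: G])
    tsum (fun n => w n `^ (1 - r) * a n y `^ r)%R)%E).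
  by apply: le_esum => y _; exact: point.
rewrite esum_swap; last by move=> y n; rewrite lee_fin mulr_ge0 ?powR_ge0.
pose B : R := c `^ r * Z `^ (r - 1) * (C `^ p^-1 * A) `^ (r - p) * A `^ p.
have B0 : 0 <= B by rewrite !mulr_ge0 ?powR_ge0.
have term n : (\esum_(y in [set: G]) (w n `^ (1 - r) * a n y `^ r)%:E <=
    (B * n.+1%:R `^ (- (eps + 1)))%:E)%E.
  rewrite -/(tsum _).
  have wa0 : 0 <= w n `^ (1 - r) * c `^ r *
      (C `^ p^-1 * A * n.+1%:R `^ (- (N%:R / 2 / p))) `^ (r - p).
    by rewrite !mulr_ge0 ?powR_ge0.
  apply: (@le_trans _ _ (tsum (fun y => w n `^ (1 - r) * c `^ r *
      (C `^ p^-1 * A * n.+1%:R `^ (- (N%:R / 2 / p))) `^ (r - p) *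
      walkn n f y `^ p))).
    apply: le_tsum => y.
    have wk : 0 <= walkn n f y by apply: walkn_ge0.
    have sup := walkn_sup_bound hS S0 C0 heat p1 n y A0 f0 fA.
    rewrite /a (powRM _ (ltW c0) wk) mulrA -[leRHS]mulrA.
    apply: ler_wpM2l; first by rewrite mulr_ge0 ?powR_ge0.
    rewrite -{1}(subrK p r) (@powRD _ _ (r - p) p); last by rewrite subrK gt_eqF.
    apply: ler_wpM2r; first exact: powR_ge0.
    by apply: ler_powR_base sup; rewrite ?subr_ge0 ?(ltW pr).
  rewrite tsumZ//; last by move=> y; exact: powR_ge0.
  apply: (le_trans (lee_wpmul2l _ (tsum_walkn_powR hS S0 p1 n f0 fA))).
    by rewrite lee_fin.
  rewrite -EFinM lee_fin le_eqVlt; apply/orP; left; apply/eqP.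
  rewrite /B /w.
  have n0 : 0 <= n.+1%:R :> R by [].
  have nP : n.+1%:R != 0 :> R by rewrite pnatr_eq0.
  rewrite powRM ?powR_ge0 ?invr_ge0 ?(ltW Z0)// powRV opprB.
  rewrite [(_ * _ * n.+1%:R `^ _) `^ (r - p)]powRM ?mulr_ge0 ?powR_ge0//.
  rewrite -!powRrM.
  have e : - (eps + 1) = - (eps + 1) * (1 - r) + - (N%:R / 2 / p) * (r - p).
    by rewrite /eps; field; rewrite !gt_eqF.
  by rewrite [in RHS]e [X in _ = _ * X]powRD ?nP ?implybT//; ring.
apply: (le_trans (le_esum (fun n _ => term n))).
rewrite -/(tsum _) tsumZ//.
apply: (le_trans (lee_wpmul2l _ weight_sum)); rewrite ?lee_fin//.
rewrite le_eqVlt; apply/orP; left; apply/eqP.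
rewrite /B /sobolev_const !powRM ?powR_ge0 ?(ltW c0) ?(ltW Z0) ?mulr_ge0 ?powR_ge0 ?(ltW c0) ?(ltW Z0)//.
rewrite -!powRrM.
have -> : (p^-1 - r^-1) * r = p^-1 * (r - p) by field; rewrite !gt_eqF.
rewrite -[in RHS](mulr_powRB1 (ltW Z0) r0).
have -> : A `^ r = A `^ (r - p) * A `^ p by rewrite -powRD subrK// gt_eqF.
ring.
Qed.

End GreenSobolev.

(** * Limits along an ultrafilter *)

Section Limits.
Context {R : realType}.

(** Limits along an ultrafilter take the place of a diagonal extraction of
    subsequences. *)
Lemma ultra_bounded_cvg (T : Type) (U : set_system T) (g : T -> R) (a b : R) :
  UltraFilter U -> (forall t, a <= g t <= b) -> exists l : R, g t @[t --> U] --> l.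
Proof.
move=> UU gab; have := @segment_compact R a b; rewrite compact_ultra.
have gU : UltraFilter (g @ U).
  split=> [|H PH gH]; first exact: fmap_proper_filter.
  apply/seteqP; split => // A HA.
  have [//|UA] := in_ultra_setVsetC (g @^-1` A) UU.
  have HnA : H (~` A) by apply: gH.
  by have /filter_ex[x []] : H (A `&` ~` A) by exact: filterI.
move=> /(_ _ gU)[]; last by move=> l [_ gl]; exists l.
by apply: (@filterS _ U _ setT) filterT => t _; rewrite /= in_itv/= gab.
Qed.

(** Monotonicity and inversion of t |-> t^r give continuity at every l >= 0,
    including l = 0, where the function need not be differentiable. *)
Lemma cvg_powR (T : Type) (F : set_system T) (FF : Filter F) (g : T -> R) (l r : R) :
  0 < r -> (forall t, 0 <= g t) -> 0 <= l ->
  g t @[t --> F] --> l -> g t `^ r @[t --> F] --> l `^ r.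
Proof.
move=> r0 g0 l0 gl; apply/cvgrPdist_le => e e0.
have lr0 : 0 <= l `^ r by exact: powR_ge0.
have up : \forall t \near F, g t `^ r <= l `^ r + e.
  have lb : l < (l `^ r + e) `^ r^-1.
    rewrite -{1}(powRK l0 (lt0r_neq0 r0)) gt0_ltr_powR ?invr_gt0 ?nnegrE ?addr_ge0 ?(ltW e0)//.
    by rewrite ltrDl.
  have := @cvgr_le _ _ _ FF _ _ gl _ lb; apply: filterS => t gt.
  rewrite -[leRHS](@powRVK _ _ r) ?gt_eqF ?addr_ge0 ?(ltW e0)//.
  by apply: ler_powR_base; rewrite ?(ltW r0).
have low : \forall t \near F, l `^ r - e <= g t `^ r.
  have [h|h] := leP (l `^ r - e) 0.
    by apply: nearW => t; apply: le_trans h (powR_ge0 _ _).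
  have lb : (l `^ r - e) `^ r^-1 < l.
    rewrite -{2}(powRK l0 (lt0r_neq0 r0)) gt0_ltr_powR ?invr_gt0 ?nnegrE ?(ltW h)//.
    by rewrite gtrBl.
  have := @cvgr_ge _ _ _ FF _ _ gl _ lb; apply: filterS => t gt.
  rewrite -[leLHS](@powRVK _ _ r) ?gt_eqF ?(ltW h)//.
  by apply: ler_powR_base; rewrite ?(ltW r0) ?powR_ge0.
apply: filterS2 up low => t h1 h2; rewrite ler_norml; apply/andP; split; lra.
Qed.

Lemma cvg_finsum (T : Type) (F : set_system T) (FF : Filter F) (I : Type) (s : seq I)
    (g : I -> T -> R) (l : I -> R) :
  (forall i, g i t @[t --> F] --> l i) ->
  \sum_(i <- s) g i t @[t --> F] --> \sum_(i <- s) l i.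
Proof.
move=> gl; elim: s => [|i s IH].
  by under eq_fun do rewrite big_nil; rewrite big_nil; exact: cvg_cst.
under eq_fun do rewrite big_cons; rewrite big_cons.
by apply: cvgD.
Qed.

Lemma fatou_powR (T : choiceType) (I : Type) (F : set_system I) (FF : ProperFilter F)
    (phi : I -> T -> R) (f : T -> R) (p A : R) : 0 < p ->
  (forall i y, 0 <= phi i y) -> (forall y, 0 <= f y) ->
  (forall i, tsum (fun y => phi i y `^ p)%R <= A%:E)%E ->
  (forall y, phi i y @[i --> F] --> f y) ->
  (tsum (fun y => f y `^ p)%R <= A%:E)%E.
Proof.
move=> p0 phi0 f0 phiA phif; apply: tsum_le_finsum => X; rewrite lee_fin.
have lim : \sum_(y <- X) phi i y `^ p @[i --> F] --> \sum_(y <- X) f y `^ p.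
  by apply: cvg_finsum => y; apply: cvg_powR.
rewrite -(cvg_lim _ lim)//; apply: limr_le; first by apply/cvg_ex; eexists; exact: lim.
apply: nearW => i; rewrite -lee_fin; apply: le_trans (phiA i).
exact: (finsum_le_tsum (fun y => phi i y `^ p)).
Qed.

End Limits.

Section GreenLimits.
Context {R : realType} {G : groupType} (S : set G) (N : nat) (C : R).
Implicit Types (f g u : G -> R) (x y : G).

Hypothesis hS : cayley_generators S.
Hypothesis S0 : S !=set0.
Hypothesis C0 : 0 < C.
Hypothesis heat : heat_decay S N C.

Local Notation walkn := (walkn (R := R) S).
Local Notation c := ((2 * degree S)^-1 : R).

Lemma cvg_walkn (I : Type) (F : set_system I) (FF : Filter F)
    (phi : I -> G -> R) f n x :
  (forall y, phi i y @[i --> F] --> f y) ->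
  walkn n (phi i) x @[i --> F] --> walkn n f x.
Proof.
move=> phif; elim: n x => [|n IH] x; first exact: phif.
rewrite /walkn/= /walk; apply: cvgD; first by apply: cvgMr; exact: IH.
by apply: cvgMr; apply: cvg_finsum => s; exact: IH.
Qed.

(** By green_tail, pointwise convergence of bounded sequences in l^p suffices. *)
Lemma green_cvg (I : Type) (F : set_system I) (FF : ProperFilter F)
    (phi : I -> G -> R) f (p A : R) x : 1 <= p -> 2 * p < N%:R -> 0 <= A ->
  (forall i y, 0 <= phi i y) -> (forall y, 0 <= f y) ->
  (forall i, tsum (fun y => phi i y `^ p)%R <= (A `^ p)%:E)%E ->
  (forall y, phi i y @[i --> F] --> f y) ->
  green S (phi i) x @[i --> F] --> green S f x.
Proof.
move=> p1 pN A0 phi0 f0 phiA phif.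
have p0 : 0 < p by apply: lt_le_trans p1.
have fA := fatou_powR FF p0 phi0 f0 phiA phif.
have NR : 0 < N%:R :> R by apply: lt_trans pN; rewrite mulr_gt0// (lt_le_trans ltr01).
pose a : R := N%:R / 2 / p - 1.
have a0 : 0 < a by rewrite subr_gt0 ltr_pdivlMr// ltr_pdivlMr// mul1r mulrC.
pose K := tail_const S N C p * A.
have K0 : 0 <= K by rewrite mulr_ge0// (tail_const_ge0 C hS S0 p1 pN).
apply/cvgrPdist_le => e e0.
pose M := Num.truncn ((K / (e / 2)) `^ a^-1).
have tail : K * M.+1%:R `^ (- a) <= e / 2.
  have /andP[_] : M%:R <= (K / (e / 2)) `^ a^-1 < M.+1%:R.
    by apply: truncn_itv; exact: powR_ge0.
  move=> /ltW h; rewrite powRN ler_pdivrMr ?powR_gt0// mulrC -ler_pdivrMr ?divr_gt0//.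
  rewrite -[leLHS](@powRVK _ _ a) ?gt_eqF ?divr_ge0 ?(ltW e0)//.
  by apply: ler_powR_base; rewrite ?(ltW a0) ?powR_ge0.
have fin g (g0 : forall y, 0 <= g y)
    (gA : (tsum (fun y => g y `^ p)%R <= (A `^ p)%:E)%E) : green_finite S g.
  exact: (green_finite_lp hS S0 C0 heat p1 pN A0 g0 gA).
have sandwich g (g0 : forall y, 0 <= g y)
    (gA : (tsum (fun y => g y `^ p)%R <= (A `^ p)%:E)%E) :
    \sum_(0 <= k < M.+1) c * walkn k g x <= green S g x <=
    \sum_(0 <= k < M.+1) c * walkn k g x + e / 2.
  rewrite green_ge_sum//=; last exact: fin.
  apply: (le_trans (green_tail hS S0 C0 heat p1 pN M x A0 g0 gA)).
  by rewrite lerD2l.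
have lim : \sum_(0 <= k < M.+1) c * walkn k (phi i) x @[i --> F] -->
    \sum_(0 <= k < M.+1) c * walkn k f x.
  by apply: cvg_finsum => k; apply: cvgMr; exact: cvg_walkn.
have /cvgrPdist_le/(_ (e / 2)) := lim; rewrite divr_gt0// => /(_ isT).
apply: filterS => i.
have /andP[] := sandwich _ (phi0 i) (phiA i).
have /andP[] := sandwich _ f0 fA.
rewrite !ler_norml => ? ? ? ? /andP[? ?]; apply/andP; split; lra.
Qed.

End GreenLimits.

(** * Extremal functions of the Sobolev inequality *)

Section Maximizer.
Context {R : realType} {G : groupType} (S : set G) (N : nat) (C : R).
Implicit Types (f g u v : G -> R) (x y : G).

Hypothesis hS : cayley_generators S.
Hypothesis S0 : S !=set0.
Hypothesis N0 : (0 < N)%N.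
Hypothesis C0 : 0 < C.
Hypothesis heat : heat_decay S N C.

Local Notation walkn := (walkn (R := R) S).
Local Notation c := ((2 * degree S)^-1 : R).
Local Notation green := (green S).

Lemma green_lp_finite (p r : R) f : 1 <= p -> 0 < r -> 2 / N%:R < p^-1 - r^-1 ->
  (forall y, 0 <= f y) -> (tsum (fun y => f y `^ p)%R < +oo)%E -> green_finite S f.
Proof.
move=> p1 r0 gain f0 ffin.
have p0 : 0 < p by apply: lt_le_trans p1.
have s0 : (0 <= tsum (fun y => f y `^ p)%R)%E.
  by apply: tsum_ge0 => y; exact: powR_ge0.
apply: (green_finite_lp hS S0 C0 heat p1 (gain_pointwise N0 p1 r0 gain)
  (A := fine (tsum (fun y => f y `^ p)) `^ p^-1)) => //; first exact: powR_ge0.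
rewrite powRVK ?gt_eqF ?fine_ge0// -tsum_fineK// => y; exact: powR_ge0.
Qed.

Lemma green_lp_lr (p r : R) f : 1 <= p -> 0 < r -> 2 / N%:R < p^-1 - r^-1 ->
  (forall y, 0 <= f y) -> (tsum (fun y => f y `^ p)%R < +oo)%E ->
  (tsum (fun y => green f y `^ r)%R < +oo)%E.
Proof.
move=> p1 r0 gain f0 ffin.
have p0 : 0 < p by apply: lt_le_trans p1.
have s0 : (0 <= tsum (fun y => f y `^ p)%R)%E.
  by apply: tsum_ge0 => y; exact: powR_ge0.
have h : (tsum (fun y => f y `^ p)%R <=
    ((fine (tsum (fun y => f y `^ p)%R) `^ p^-1) `^ p)%:E)%E.
  by rewrite powRVK ?gt_eqF ?fine_ge0// -tsum_fineK// => y; exact: powR_ge0.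
apply: le_lt_trans (ltry _).
exact: (green_sobolev hS S0 C0 heat N0 p1 r0 gain (powR_ge0 _ _) f0 h).
Qed.

Variables p q : R.
Hypothesis p1 : 1 < p.
Hypothesis q0 : 0 < q.
Hypothesis gain : 2 / N%:R < p^-1 - q^-1.

Let p0 : 0 < p. Proof. exact: lt_trans p1. Qed.
Let p1' : 1 <= p. Proof. exact: ltW. Qed.
Let pq : p < q. Proof. exact: (gain_lt N0 p1' q0 gain). Qed.
Let q1 : 1 < q. Proof. exact: lt_trans p1 pq. Qed.

Definition admissible f : Prop :=
  (forall y, 0 <= f y) /\ (tsum (fun y => f y `^ p)%R <= 1)%E.

(** Restricting to f >= 0 loses nothing, since |K f| <= K |f|. *)
Definition sobolev_values : set R :=
  [set m | exists2 f, admissible f & tsum (fun y => green f y `^ q) = m%:E].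

Definition sobolev_sup : R := sup sobolev_values.
Local Notation M := sobolev_sup.

Let pN : 2 * p < N%:R. Proof. exact: (gain_pointwise N0 p1' q0 gain). Qed.

Lemma admissible_finite f : admissible f -> green_finite S f.
Proof.
move=> [f0 f1]; apply: (green_lp_finite p1' q0 gain f0).
exact: le_lt_trans f1 (ltry _).
Qed.

Let K : R := sobolev_const S N C p q * 1.

Let admissible_bound f : admissible f ->
  (tsum (fun y => green f y `^ q)%R <= (K `^ q)%:E)%E.
Proof.
move=> [f0 f1]; apply: (green_sobolev hS S0 C0 heat N0 p1' q0 gain ler01 f0).
by rewrite powR1.
Qed.

Lemma admissible_value f : admissible f ->
  exists2 m, sobolev_values m & tsum (fun y => green f y `^ q) = m%:E.
Proof.
move=> af; exists (fine (tsum (fun y => green f y `^ q))).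
  exists f => //; apply: tsum_fineK => [y|]; first exact: powR_ge0.
  exact: le_lt_trans (admissible_bound af) (ltry _).
apply: tsum_fineK => [y|]; first exact: powR_ge0.
exact: le_lt_trans (admissible_bound af) (ltry _).
Qed.

Lemma sobolev_values_sup : has_sup sobolev_values.
Proof.
split.
  have a0 : admissible (fun=> 0).
    split=> //; rewrite (@eq_tsum _ _ _ (fun=> 0)) ?/tsum ?esum1//.
    by move=> y; rewrite powR0// gt_eqF.
  by have [m hm _] := admissible_value a0; exists m.
by exists (K `^ q) => m [f /admissible_bound + e]; rewrite e lee_fin.
Qed.

Lemma admissible_le_sup f : admissible f ->
  (tsum (fun y => green f y `^ q)%R <= M%:E)%E.
Proof.
move=> /admissible_value[m hm ->]; rewrite lee_fin.
exact: (ub_le_sup sobolev_values_sup.2).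
Qed.

Lemma sobolev_sup_gt0 : 0 < M.
Proof.
have ad : admissible (point_mass 1%g).
  split; first exact: point_mass_ge0.
  rewrite -(tsum_point_mass (R := R) (1%g : G)); apply: le_tsum => y; rewrite /point_mass.
  by case: (y == 1%g); rewrite ?powR1// powR0// gt_eqF.
rewrite -lte_fin; apply: lt_le_trans (admissible_le_sup ad).
apply: (tsum_gt0 (x := 1%g)); first by move=> y; exact: powR_ge0.
rewrite powR_gt0//; apply: (@lt_le_trans _ _ c).
  by rewrite invr_gt0 mulr_gt0// degree_gt0.
have := green_ge_sum hS S0 1%g 1 (@point_mass_ge0 _ _ 1%g) (admissible_finite ad).
by rewrite big_nat1 /= /point_mass eqxx mulr1.
Qed.

Lemma sobolev_sup_ineq f a : 0 < a -> (forall y, 0 <= f y) ->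
  (tsum (fun y => f y `^ p)%R <= (a `^ p)%:E)%E ->
  (tsum (fun y => green f y `^ q)%R <= (M * a `^ q)%:E)%E.
Proof.
move=> a0 f0 fa.
have ad : admissible (fun y => a^-1 * f y).
  split; first by move=> y; rewrite mulr_ge0 ?invr_ge0 ?(ltW a0).
  rewrite (@eq_tsum _ _ _ (fun y => (a `^ p)^-1 * f y `^ p)); last first.
    by move=> y; rewrite powRM ?invr_ge0 ?(ltW a0)// powRV powRN.
  rewrite tsumZ ?invr_ge0 ?powR_ge0//; last by move=> y; exact: powR_ge0.
  by rewrite lee_pdivrMl ?powR_gt0// mule1.
have ff : green_finite S f.
  apply: (green_lp_finite p1' q0 gain f0); exact: le_lt_trans fa (ltry _).
have := admissible_le_sup ad.
rewrite (@eq_tsum _ _ _ (fun y => (a `^ q)^-1 * green f y `^ q)); last first.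
  move=> y; rewrite greenZ ?invr_ge0 ?(ltW a0)//.
  by rewrite powRM ?invr_ge0 ?(ltW a0) ?green_ge0// powRV powRN.
rewrite tsumZ ?invr_ge0 ?powR_ge0//; last by move=> y; exact: powR_ge0.
by rewrite lee_pdivrMl ?powR_gt0// -EFinM mulrC.
Qed.

Let q' : R := q / (q - 1).
Let p' : R := p / (p - 1).

Let pm1 : 0 < p - 1. Proof. by rewrite subr_gt0. Qed.
Let qm1 : 0 < q - 1. Proof. by rewrite subr_gt0. Qed.

(** 1/q' - 1/p' = 1/p - 1/q: the range of exponents of K is self-dual. *)
Lemma dual_gain : 2 / N%:R < q'^-1 - p'^-1.
Proof.
apply: (lt_le_trans gain); rewrite le_eqVlt; apply/orP; left; apply/eqP.
by rewrite /q' /p'; field; rewrite !gt_eqF.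
Qed.

Lemma dual_exponent_ge1 : 1 <= q'.
Proof. by rewrite /q' ler_pdivlMr// mul1r gerBl. Qed.

Lemma dual_exponent_gt0 : 0 < p'.
Proof. by rewrite /p' divr_gt0. Qed.

Let q'1 := dual_exponent_ge1.
Let p'0 := dual_exponent_gt0.

Lemma powR_dual_exponent (t : R) : (t `^ (q - 1)) `^ q' = t `^ q.
Proof. by rewrite -powRrM /q' mulrC divfK ?gt_eqF. Qed.

Lemma powR_green_finite u : (forall y, 0 <= u y) ->
  (tsum (fun y => u y `^ q)%R < +oo)%E ->
  green_finite S (fun y => u y `^ (q - 1)).
Proof.
move=> u0 uf; apply: (green_lp_finite q'1 p'0 dual_gain).
  by move=> y; exact: powR_ge0.
by under eq_tsum do rewrite powR_dual_exponent.
Qed.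

Lemma powR_green_lp u : (forall y, 0 <= u y) ->
  (tsum (fun y => u y `^ q)%R < +oo)%E ->
  (tsum (fun x => green (fun y => u y `^ (q - 1)) x `^ p')%R < +oo)%E.
Proof.
move=> u0 uf; apply: (green_lp_lr q'1 p'0 dual_gain).
  by move=> y; exact: powR_ge0.
by under eq_tsum do rewrite powR_dual_exponent.
Qed.

(** The function e for which e^(p-1) = K ((K f)^(q-1)) / M.  The
    Euler-Lagrange equation says f = e; working with e rather than with its
    power keeps every estimate in l^p. *)
Definition dual_potential f x : R :=
  (M^-1 * green (fun y => green f y `^ (q - 1)) x) `^ (p - 1)^-1.

Lemma dual_potential_ge0 f x : 0 <= dual_potential f x.
Proof. exact: powR_ge0. Qed.

Section OneFunction.
Variable f : G -> R.
Hypothesis adf : admissible f.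
Local Notation u := (green f).
Local Notation e := (dual_potential f).
Local Notation h := (fun x => M^-1 * green (fun y => u y `^ (q - 1)) x).

Let f0 : forall y, 0 <= f y. Proof. by case: adf. Qed.
Let M0 : 0 < M := sobolev_sup_gt0.
Let u0 y : 0 <= u y. Proof. exact: green_ge0. Qed.
Let uM : (tsum (fun y => u y `^ q)%R <= M%:E)%E.
Proof. exact: admissible_le_sup. Qed.
Let uf : (tsum (fun y => u y `^ q)%R < +oo)%E.
Proof. exact: le_lt_trans uM (ltry _). Qed.
Let uq0 y : 0 <= u y `^ (q - 1). Proof. exact: powR_ge0. Qed.
Let Kf : green_finite S (fun y => u y `^ (q - 1)).
Proof. exact: powR_green_finite. Qed.
Let h0 x : 0 <= h x.
Proof. by rewrite mulr_ge0 ?invr_ge0 ?(ltW M0)// green_ge0. Qed.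

Lemma dual_potentialK x : e x `^ (p - 1) = h x.
Proof. by rewrite /dual_potential powRVK// gt_eqF. Qed.

Let eE x : e x `^ p = (M^-1) `^ p' * green (fun y => u y `^ (q - 1)) x `^ p'.
Proof.
rewrite /dual_potential -powRrM [_ * p]mulrC -/p' powRM//.
  by rewrite invr_ge0 ltW.
exact: green_ge0.
Qed.

Let e_fin : (tsum (fun x => e x `^ p)%R < +oo)%E.
Proof.
rewrite (eq_tsum eE) tsumZ ?powR_ge0//; last by move=> x; exact: powR_ge0.
have : (tsum (fun x => green (fun y => u y `^ (q - 1)) x `^ p')%R < +oo)%E.
  exact: powR_green_lp.
move=> /tsum_fineK ->; first by rewrite -EFinM ltry.
by move=> x; exact: powR_ge0.
Qed.

(** By the symmetry of K, pairing with the right-hand side of the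
    Euler-Lagrange equation becomes a pairing of K v with (K f)^(q-1). *)
Lemma pairing v : (forall y, 0 <= v y) -> green_finite S v ->
  tsum (fun x => v x * e x `^ (p - 1)) =
  (M^-1%:E * tsum (fun x => green v x * u x `^ (q - 1))%R)%E.
Proof.
move=> v0 vf; rewrite -green_dual// -tsumZ ?invr_ge0 ?(ltW M0)//.
  by apply: eq_tsum => x; rewrite dual_potentialK mulrCA.
by move=> x; rewrite mulr_ge0// green_ge0.
Qed.

(** Duality: with H = sum e^p, pairing e with e^(p-1) and applying Hoelder
    and the Sobolev inequality gives H <= H^(1/p).  The finiteness of H, needed
    to conclude, comes from the Sobolev inequality for the dual exponents. *)
Lemma dual_potential_le1 : (tsum (fun x => e x `^ p)%R <= 1)%E.
Proof.
have H0 : (0 <= tsum (fun x => e x `^ p)%R)%E.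
  by apply: tsum_ge0 => x; exact: powR_ge0.
have HE : tsum (fun x => e x `^ p) = (fine (tsum (fun x => e x `^ p)))%:E.
  by apply: tsum_fineK => // x; exact: powR_ge0.
set H := fine _ in HE.
have Hge : 0 <= H by exact: fine_ge0.
rewrite HE lee_fin.
have [->//|Hn0] := eqVneq H 0.
have Hgt : 0 < H by rewrite lt_neqAle eq_sym Hn0.
pose k := H `^ p^-1.
have k0 : 0 < k by exact: powR_gt0.
have kp : k `^ p = H by rewrite /k powRVK// gt_eqF.
have ef : green_finite S e.
  exact: (green_lp_finite p1' q0 gain (dual_potential_ge0 f) e_fin).
have Ke : (tsum (fun y => green e y `^ q)%R <= ((M `^ q^-1 * k) `^ q)%:E)%E.
  rewrite powRM ?powR_ge0// powRVK ?(ltW M0) ?gt_eqF//.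
  apply: sobolev_sup_ineq => //; first exact: dual_potential_ge0.
  by rewrite kp HE.
have Mq0 : 0 < M `^ q^-1 by exact: powR_gt0.
have uq : (tsum (fun y => u y `^ q)%R <= ((M `^ q^-1) `^ q)%:E)%E.
  by rewrite powRVK ?(ltW M0) ?gt_eqF.
have ge0 : forall y, 0 <= green e y.
  by move=> y; apply: green_ge0 => //; exact: dual_potential_ge0.
have := hoelder_tsum (ltW q1) (mulr_gt0 Mq0 k0) Mq0 ge0 u0 Ke uq.
move=> /(@lee_wpmul2l _ M^-1%:E); rewrite lee_fin invr_ge0 (ltW M0) => /(_ isT).
rewrite -pairing//; last exact: dual_potential_ge0.
rewrite (@eq_tsum _ _ _ (fun x => e x `^ p)); last first.
  by move=> x; rewrite mulr_powRB1// dual_potential_ge0.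
rewrite HE -EFinM lee_fin [_ * k * _]mulrAC mulr_powRB1 ?(ltW Mq0)//.
rewrite powRVK ?(ltW M0) ?gt_eqF// mulKf ?gt_eqF// => Hk.
have [k1|k1] := leP k 1.
  exact: le_trans Hk k1.
move: Hk; rewrite -kp -(mulr_powRB1 (ltW k0) p0) ger_pMr// => Hk.
have : 1 `^ (p - 1) < k `^ (p - 1) by rewrite gt0_ltr_powR ?nnegrE ?(ltW k0).
by rewrite powR1 ltNge Hk.
Qed.

(** The left-hand side is the defect in Young's inequality at x.  All defects
    are nonnegative, and their sum is at most p (1 - m / M) with
    m = sum (K f)^q; hence so is each of them. *)
Lemma euler_lagrange_defect x :
  f x `^ p + (p - 1) * e x `^ p - p * e x `^ (p - 1) * f x <=
  p * (1 - fine (tsum (fun y => u y `^ q)) / M).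
Proof.
set m := fine _.
have mE : tsum (fun y => u y `^ q) = m%:E.
  by apply: tsum_fineK => // y; exact: powR_ge0.
pose D x := f x `^ p + (p - 1) * e x `^ p - p * e x `^ (p - 1) * f x.
have D0 y : 0 <= D y.
  by rewrite subr_ge0; apply: powR_tangent => //; exact: dual_potential_ge0.
have split : (tsum D + (p * (m / M))%:E =
    tsum (fun x => f x `^ p + (p - 1) * e x `^ p)%R)%E.
  have -> : (p * (m / M))%:E = tsum (fun x => p * (f x * e x `^ (p - 1))).
    rewrite tsumZ ?(ltW p0)//; last by move=> y; rewrite mulr_ge0 ?powR_ge0.
    rewrite pairing//; last exact: admissible_finite.
    rewrite (@eq_tsum _ _ (fun y => u y * u y `^ (q - 1)) (fun y => u y `^ q)).
      by rewrite mE -!EFinM [m / M]mulrC.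
    by move=> y; rewrite mulr_powRB1.
  rewrite -tsumD//; last by move=> y; rewrite !mulr_ge0 ?(ltW p0) ?powR_ge0.
  by apply: eq_tsum => y; rewrite /D; ring.
have : (tsum D + (p * (m / M))%:E <= p%:E)%E.
  rewrite split tsumD; last 2 first.
  - by move=> y; exact: powR_ge0.
  - by move=> y; rewrite mulr_ge0 ?powR_ge0 ?(ltW pm1).
  rewrite tsumZ ?(ltW pm1)//; last by move=> y; exact: powR_ge0.
  have -> : p%:E = (1 + (p - 1)%:E * 1)%E.
    by rewrite mule1 -EFinD addrC subrK.
  apply: leeD; first by case: adf.
  by apply: lee_wpmul2l; rewrite ?lee_fin ?(ltW pm1)// dual_potential_le1.
rewrite -leeBrDr// -EFinB => h1.
have := le_trans (term_le_tsum D x) h1; rewrite lee_fin /D => h2.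
apply: (le_trans h2); rewrite le_eqVlt; apply/orP; left; apply/eqP; ring.
Qed.

End OneFunction.

(** Since 1/p - 1/q > 2/N is an open condition, K also maps l^p to l^r for
    some r < q.  If K f were smaller than c1 everywhere, sum (K f)^q would be at
    most c1^(q-r) sum (K f)^r, which is too small. *)
Lemma nonvanishing : exists2 c1, 0 < c1 & forall f, admissible f ->
  ((M / 2)%:E <= tsum (fun y => green f y `^ q)%R)%E -> exists x, c1 <= green f x.
Proof.
have M0 := sobolev_sup_gt0.
(* r lies strictly between the critical exponent and q *)
pose s : R := (q^-1 + (p^-1 - 2 / N%:R)) / 2; pose r := s^-1.
have qi0 : 0 < q^-1 by rewrite invr_gt0.
have sq : q^-1 < s.
  by rewrite /s ltr_pdivlMr// mulr_natr mulr2n ltrD2l ltrBrDr addrC -ltrBrDr.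
have sb : s < p^-1 - 2 / N%:R.
  by rewrite /s ltr_pdivrMr// mulr_natr mulr2n ltrD2r ltrBrDr addrC -ltrBrDr.
have s0 : 0 < s by exact: lt_trans sq.
have r0 : 0 < r by rewrite invr_gt0.
have rq : r < q by rewrite /r -[q]invrK ltf_pV2.
have gain_r : 2 / N%:R < p^-1 - r^-1 by rewrite /r invrK ltrBrDr addrC -ltrBrDr.
pose Kr := (sobolev_const S N C p r * 1) `^ r.
have Kr0 : 0 < Kr.
  by rewrite powR_gt0// mulr1; apply: (sobolev_const_gt0 hS S0 C0 N0 gain_r).
(* c1^(q - r) Kr = M / 4 *)
pose c1 := (M / (4 * Kr)) `^ (q - r)^-1.
have c10 : 0 < c1 by rewrite powR_gt0// divr_gt0// mulr_gt0.
exists c1 => // f adf hM; apply: contrapT => no.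
have lt_c1 x : green f x < c1 by rewrite ltNge; apply/negP => h; apply: no; exists x.
have u0 x : 0 <= green f x by apply: green_ge0 => //; case: adf.
have hr : (tsum (fun y => green f y `^ r)%R <= Kr%:E)%E.
  case: adf => f0 f1.
  apply: (green_sobolev hS S0 C0 heat N0 p1' r0 gain_r ler01 f0).
  by rewrite powR1.
have : (tsum (fun y => green f y `^ q)%R <= (M / 4)%:E)%E.
  apply: (@le_trans _ _ (tsum (fun y => c1 `^ (q - r) * green f y `^ r))).
    apply: le_tsum => y; rewrite -{1}(subrK r q) (@powRD _ _ (q - r) r); last first.
      by rewrite subrK gt_eqF.
    apply: ler_wpM2r; first exact: powR_ge0.
    by apply: ler_powR_base; [rewrite subr_ge0 ltW|exact: u0|exact: ltW].
  rewrite tsumZ ?powR_ge0//; last by move=> y; exact: powR_ge0.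
  apply: (le_trans (lee_wpmul2l _ hr)); first by rewrite lee_fin powR_ge0.
  rewrite -EFinM lee_fin /c1 powRVK ?subr_eq0 ?(gt_eqF rq)//; last first.
    by rewrite divr_ge0 ?mulr_ge0 ?(ltW M0) ?(ltW Kr0).
  by rewrite le_eqVlt; apply/orP; left; apply/eqP; field; rewrite gt_eqF.
move=> /(le_trans hM); rewrite lee_fin ler_pM2l// lef_pV2 ?posrE//.
by rewrite ler_nat.
Qed.

Lemma admissible_translate f z : admissible f -> admissible (fun y => f (z * y)%g).
Proof.
move=> [f0 f1]; split=> [y|]; first exact: f0.
by rewrite (tsum_mulgl (fun y => f y `^ p) z).
Qed.

Lemma maximizing_sequence : exists2 c1, 0 < c1 & exists F : nat -> G -> R,
  forall n, [/\ admissible (F n), c1 <= green (F n) 1%g &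
    1 - fine (tsum (fun y => green (F n) y `^ q)) / M <= n.+1%:R^-1].
Proof.
have M0 := sobolev_sup_gt0.
have [c1 c10 hc1] := nonvanishing; exists c1 => //.
suff : forall n, exists f, [/\ admissible f, c1 <= green f 1%g &
    1 - fine (tsum (fun y => green f y `^ q)) / M <= n.+1%:R^-1].
  by move=> /choice[F hF]; exists F.
move=> n; have n0 : 0 < (2 * n.+1%:R)^-1 :> R by rewrite invr_gt0 mulr_gt0.
have [m [f adf fm] mM] := sup_adherent (mulr_gt0 M0 n0) sobolev_values_sup.
rewrite -/M in mM.
have n2 : (2 * n.+1%:R)^-1 <= 2^-1 :> R.
  by rewrite lef_pV2 ?posrE ?mulr_gt0// ler_peMr// ler1n.
have Mm : M / 2 <= m.
  apply: le_trans (ltW mM); have : M * (2 * n.+1%:R)^-1 <= M / 2 by rewrite ler_pM2l.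
  by move: (M * _) => a; lra.
have [|z hz] := hc1 f adf; first by rewrite fm lee_fin.
exists (fun y => f (z * y)%g); split; first exact: admissible_translate.
  by rewrite green_translate mulg1.
under eq_tsum do rewrite green_translate.
rewrite (tsum_mulgl (fun y => green f y `^ q) z) fm/=.
apply: (@le_trans _ _ (2 * n.+1%:R)^-1); last first.
  by rewrite lef_pV2 ?posrE ?mulr_gt0// ler_peMl// ler1n.
rewrite lerBlDr -lerBlDl ler_pdivlMr// mulrBl mul1r [_^-1 * M]mulrC.
exact: ltW.
Qed.

(** The pointwise limit of a normalized maximizing sequence satisfies the
    Euler-Lagrange equation, and is not zero by nonvanishing.  No mass is lost,
    because the equation paired with f gives sum f^p <= (sum f^p)^(q/p) with
    q > p. *)
Theorem extremal_exists : exists f, [/\ forall y, 0 <= f y,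
  tsum (fun y => f y `^ p) = 1%E,
  tsum (fun y => green f y `^ q) = M%:E &
  forall x, f x `^ (p - 1) = M^-1 * green (fun y => green f y `^ (q - 1)) x].
Proof.
have M0 := sobolev_sup_gt0.
have [c1 c10 [F hF]] := maximizing_sequence.
have [U [UU ooU]] := ultraFilterLemma eventually_filter.
have UP : ProperFilter U by exact: ultra_proper.
have F0 n y : 0 <= F n y by have [[]] := hF n.
have Fp n : (tsum (fun y => F n y `^ p)%R <= (1 `^ p)%:E)%E.
  by rewrite powR1; have [[]] := hF n.
have F1 n y : F n y <= 1.
  apply: (powR_lerP p0) => //; rewrite -lee_fin; apply: le_trans (Fp n).
  exact: (term_le_tsum (fun y => F n y `^ p)).
have /choice[f Ff] : forall y, exists l : R, F n y @[n --> U] --> l.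
  move=> y; apply: (@ultra_bounded_cvg _ _ _ _ 0 1) => n.
  by rewrite F0 F1.
have lim_ge (g : nat -> R) (l a : R) : (forall n, a <= g n) ->
    g n @[n --> U] --> l -> a <= l.
  move=> ag gl; rewrite -(cvg_lim _ gl)//; apply: limr_ge.
    by apply/cvg_ex; exists l.
  exact: nearW.
have f0 y : 0 <= f y by apply: lim_ge (Ff y).
have fp : (tsum (fun y => f y `^ p)%R <= 1)%E.
  by have := fatou_powR UP p0 F0 f0 Fp Ff; rewrite powR1.
have adf : admissible f by [].
have cvgu y : green (F n) y @[n --> U] --> green f y.
  exact: (green_cvg hS S0 C0 heat UP p1' pN ler01 F0 f0 Fp Ff).
have u0 y : 0 <= green f y by exact: green_ge0.
have uF0 n y : 0 <= green (F n) y by apply: green_ge0.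
have cvguq y : green (F n) y `^ (q - 1) @[n --> U] --> green f y `^ (q - 1).
  exact: cvg_powR.
have q'0 : 0 < q' by exact: lt_le_trans q'1.
have Mq : M = (M `^ q'^-1) `^ q' by rewrite powRVK ?(ltW M0) ?gt_eqF.
have uqM n : (tsum (fun y => (green (F n) y `^ (q - 1)) `^ q')%R <=
    ((M `^ q'^-1) `^ q')%:E)%E.
  rewrite -Mq; under eq_tsum do rewrite powR_dual_exponent.
  by apply: admissible_le_sup; have [] := hF n.
have cvgh x : green (fun y => green (F n) y `^ (q - 1)) x @[n --> U] -->
    green (fun y => green f y `^ (q - 1)) x.
  apply: (green_cvg hS S0 C0 heat UP q'1 (gain_pointwise N0 q'1 p'0 dual_gain)
    (powR_ge0 _ _) _ _ uqM cvguq) => *; exact: powR_ge0.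
have hF0 n x : 0 <= M^-1 * green (fun y => green (F n) y `^ (q - 1)) x.
  rewrite mulr_ge0 ?invr_ge0 ?(ltW M0)// green_ge0// => y; exact: powR_ge0.
have h0 x : 0 <= M^-1 * green (fun y => green f y `^ (q - 1)) x.
  rewrite mulr_ge0 ?invr_ge0 ?(ltW M0)// green_ge0// => y; exact: powR_ge0.
have cvge x : dual_potential (F n) x @[n --> U] --> dual_potential f x.
  by apply: cvg_powR => //; [rewrite invr_gt0|apply: cvgMr; exact: cvgh].
have EL x : f x `^ (p - 1) = M^-1 * green (fun y => green f y `^ (q - 1)) x.
  rewrite -(dual_potentialK f x); congr (_ `^ _).
  apply: (@powR_tangent_eq _ p) => //; first exact: dual_potential_ge0.
  apply/eqP; rewrite eq_le powR_tangent//=; last exact: dual_potential_ge0.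
  rewrite -subr_le0; apply/ler_addgt0Pr => d d0; rewrite add0r.
  pose D n := F n x `^ p + (p - 1) * dual_potential (F n) x `^ p -
    p * dual_potential (F n) x `^ (p - 1) * F n x.
  have cvgD : D n @[n --> U] --> f x `^ p + (p - 1) * dual_potential f x `^ p -
      p * dual_potential f x `^ (p - 1) * f x.
    apply: cvgB.
      apply: cvgD; first exact: cvg_powR.
      by apply: cvgMr; apply: cvg_powR => // *; exact: dual_potential_ge0.
    apply: cvgM => //; apply: cvgMr.
    by apply: cvg_powR => // *; exact: dual_potential_ge0.
  rewrite -(cvg_lim _ cvgD)//; apply: limr_le; first by apply/cvg_ex; eexists; exact: cvgD.
  apply: ooU; near=> n.
  have [adF _ hn] := hF n.
  apply: (le_trans (euler_lagrange_defect adF x)).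
  apply: (le_trans (ler_wpM2l (ltW p0) hn)).
  rewrite ler_pdivrMr// mulrC -ler_pdivrMr//; apply: (@le_trans _ _ n%:R).
    by near: n; exact: nbhs_infty_ger.
  by rewrite ler_nat.
have paired : tsum (fun y => f y `^ p) =
    (M^-1%:E * tsum (fun y => green f y `^ q)%R)%E.
  have -> : tsum (fun y => f y `^ p) =
      tsum (fun y => f y * dual_potential f y `^ (p - 1)).
    by apply: eq_tsum => y; rewrite dual_potentialK// -EL mulr_powRB1.
  rewrite pairing//; last exact: admissible_finite.
  by congr (_ * _)%E; apply: eq_tsum => y; rewrite mulr_powRB1.
have fE : tsum (fun y => f y `^ p) = (fine (tsum (fun y => f y `^ p)))%:E.
  apply: tsum_fineK => [y|]; first exact: powR_ge0.
  exact: le_lt_trans fp (ltry _).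
set a := fine _ in fE.
have a0 : 0 < a.
  rewrite lt_neqAle eq_sym; apply/andP; split; last first.
    by apply/fine_ge0/tsum_ge0 => y; exact: powR_ge0.
  apply/eqP => az.
  have fz : f = (fun y => 0 * f y).
    apply/funext => y; rewrite mul0r; apply: (@powR_eq0_eq0 _ _ p).
    apply/eqP; rewrite eq_le powR_ge0 andbT -lee_fin -[X in (_ <= X%:E)%E]az -fE.
    exact: (term_le_tsum (fun y => f y `^ p)).
  have := lim_ge _ _ _ (fun n => let: And3 _ h _ := hF n in h) (cvgu 1%g).
  rewrite fz greenZ//; last exact: admissible_finite.
  by rewrite mul0r leNgt c10.
pose k := a `^ p^-1.
have k0 : 0 < k by exact: powR_gt0.
have kp : k `^ p = a by rewrite /k powRVK ?(ltW a0)// gt_eqF.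
have hk : k `^ p <= k `^ q.
  rewrite kp -lee_fin -fE paired.
  have : (tsum (fun y => green f y `^ q)%R <= (M * k `^ q)%:E)%E.
    by apply: sobolev_sup_ineq => //; rewrite kp fE.
  move=> /(@lee_wpmul2l _ M^-1%:E); rewrite lee_fin invr_ge0 (ltW M0) => /(_ isT).
  by move=> /le_trans; apply; rewrite -EFinM mulKf ?gt_eqF.
have k1 : 1 <= k.
  apply: (@powR_lerP _ _ _ (q - p)); rewrite ?subr_gt0 ?(ltW k0)// powR1.
  by rewrite powRB ?(gt_eqF k0) ?implybT// ler_pdivlMr ?mul1r// powR_gt0.
have a1 : a = 1.
  apply/eqP; rewrite eq_le -lee_fin -fE fp/= -kp.
  have := @ler_powR_base _ 1 k p (ltW p0) ler01 k1.
  by rewrite powR1.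
have f1 : tsum (fun y => f y `^ p) = 1%E by rewrite fE a1.
exists f; split => //.
have uE : tsum (fun y => green f y `^ q) = (fine (tsum (fun y => green f y `^ q)))%:E.
  apply: tsum_fineK => [y|]; first exact: powR_ge0.
  exact: le_lt_trans (admissible_le_sup adf) (ltry _).
have [h] : 1%:E = (M^-1 * fine (tsum (fun y => green f y `^ q)))%:E :> \bar R.
  by rewrite EFinM -uE -paired f1.
rewrite uE; congr _%:E.
by apply: (mulfI (invr_neq0 (lt0r_neq0 M0))); rewrite -h mulVf ?gt_eqF.
Unshelve. all: by end_near.
Qed.

End Maximizer.

(** * Harmonic functions on the Cayley graph *)

Section CayleyGraph.
Context {R : realType} {G : groupType} (S : set G).
Implicit Types (u v w : G -> R) (x y : G).

Hypothesis hS : cayley_generators S.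

(** The elements g such that Z is invariant under right translation by g and
    by its inverse form a subgroup, which contains S because S is closed under
    inverses. *)
Lemma cayley_connected (Z : set G) x0 :
  (forall x s, S s -> Z x -> Z (x * s)%g) -> Z x0 -> forall x, Z x.
Proof.
move=> ZS Z0; have [_ symS gen] := hS.
pose H : set G := [set g | forall x, Z x <-> Z (x * g)%g].
have subH : is_subgroup H.
  split=> [x|a b Ha Hb x|a Ha x]; first by rewrite mulg1.
    by rewrite mulgA (Ha x) (Hb (x * a)%g).
  by have := Ha (x * a^-1)%g; rewrite -mulgA mulVg mulg1 => <-.
have SH : S `<=` H.
  move=> s Ss x; split; first exact: ZS.
  by move=> /(ZS _ _ ((symS s).1 Ss)); rewrite -mulgA mulgV mulg1.
have HT g : H g.
  have : [set: G] g by [].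
  by rewrite -gen; apply; split.
by move=> x; have := HT (x0^-1 * x)%g x0; rewrite mulgA mulgV mul1g => h; apply/h.
Qed.

Lemma generators_nonempty : infinite_set [set: G] -> S !=set0.
Proof.
move=> infG; apply/set0P/eqP => SE; apply: infG.
have -> : [set: G] = [set 1%g]; last exact: finite_set1.
apply/seteqP; split=> // x _; apply: (@cayley_connected [set 1%g] 1%g) => //.
by move=> y s; rewrite SE.
Qed.

Lemma polynomial_growth_infinite (N : nat) : (0 < N)%N ->
  polynomial_growth R S N -> infinite_set [set: G].
Proof.
move=> N0 [C1 [C2 [C10 _ hV]]] finG.
pose m := #|` fset_set [set: G]|.
have bound n : (growth S n <= m)%N.
  apply: fsubset_leq_card; apply/fsubsetP => x _.
  by rewrite in_fset_set// inE.
pose n := (Num.truncn (m%:R / C1)).+1.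
have /andP[_ mn] : (Num.truncn (m%:R / C1))%:R <= m%:R / C1 < n%:R.
  by apply: truncn_itv; rewrite divr_ge0// ltW.
have /andP[h _] := hV n isT.
have : C1 * n%:R <= m%:R.
  apply: le_trans (_ : C1 * n%:R ^+ N <= _); last first.
    by apply: (le_trans h); rewrite ler_nat.
  by rewrite ler_pM2l// -[leLHS]expr1; apply: ler_weXn2l => //; rewrite ler1n.
by rewrite leNgt mulrC -ltr_pdivrMr// mn.
Qed.

(** The function tends to zero at infinity on the discrete set G. *)
Definition vanishing v := forall e, 0 < e -> finite_set [set x | e <= `|v x|].

Lemma vanishingD v w : vanishing v -> vanishing w -> vanishing (fun x => v x + w x).
Proof.
move=> hv hw e e0; have e2 : 0 < e / 2 by rewrite divr_gt0.
apply: sub_finite_set (_ : _ `<=` [set x | e / 2 <= `|v x|] `|` [set x | e / 2 <= `|w x|]) _; last first.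
  by rewrite finite_setU; split; [exact: hv|exact: hw].
move=> x /= h; have [h1|h1] := leP (e / 2) `|v x|; [by left|right].
have := ler_normD (v x) (w x); lra.
Qed.

Lemma vanishingN v : vanishing v -> vanishing (fun x => - v x).
Proof.
by move=> hv e e0; under eq_set do rewrite normrN; exact: hv.
Qed.

Lemma vanishing_lp v (r : R) : 0 < r ->
  (tsum (fun x => `|v x| `^ r)%R < +oo)%E -> vanishing v.
Proof.
move=> r0 fin e e0; apply: contrapT => inf.
have vr0 x : 0 <= `|v x| `^ r by exact: powR_ge0.
have sE := tsum_fineK vr0 fin; set s := fine _ in sE.
have er0 : 0 < e `^ r by exact: powR_gt0.
have s0 : 0 <= s by exact/fine_ge0/tsum_ge0.
pose n := (Num.truncn (s / e `^ r)).+1.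
have /andP[_ sn] : (Num.truncn (s / e `^ r))%:R <= s / e `^ r < n%:R.
  by apply: truncn_itv; rewrite divr_ge0// ltW.
have [X XA nX] := infinite_set_fset n inf.
have : \sum_(x <- X) `|v x| `^ r <= s.
  by rewrite -lee_fin -sE; exact: finsum_le_tsum.
apply/negP; rewrite -ltNge.
apply: (@lt_le_trans _ _ (\sum_(x <- X) e `^ r)).
  rewrite big_const_seq count_predT iter_addr_0 -mulr_natr mulrC.
  rewrite -ltr_pdivrMr//; apply: (lt_le_trans sn); rewrite ler_nat//.
rewrite big_seq [leRHS]big_seq; apply: ler_sum => x xX.
apply: ler_powR_base; rewrite ?(ltW r0) ?(ltW e0)//.
exact: XA.
Qed.

Hypothesis infG : infinite_set [set: G].

Let finS : finite_set S. Proof. by case: hS. Qed.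

(** If v takes a positive value, its decay makes it attain its maximum.
    The set where it does so is closed under taking neighbours, so it is the
    infinite group G, against the decay. *)
Lemma maximum_principle v : vanishing v -> (forall x, laplacian S v x = 0) ->
  forall x, v x <= 0.
Proof.
move=> vanv harm x0; rewrite leNgt; apply/negP => v0.
have finL := vanv _ v0.
pose L := fset_set [set x | v x0 <= `|v x|].
have x0L : x0 \in L by rewrite /L in_fset_set// inE/= gtr0_norm.
have [x1 hx1] : exists x1, forall x, v x <= v x1.
  (* a maximum over the finite level set L is a maximum over G *)
  pose x1 := [arg max_(y > [` x0L]%fset) v (val y)]%O.
  have hmax y : y \in L -> v y <= v (val x1).
    by move=> yL; rewrite /x1; case: arg_maxP => // z _ /(_ [` yL]%fset isT).
  exists (val x1) => x; have [h|h] := leP (v x0) `|v x|.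
    by apply: hmax; rewrite /L in_fset_set// inE.
  by apply: le_trans (hmax _ x0L); apply: le_trans (ler_norm _) (ltW h).
have vcst : forall x, v x = v x1.
  apply: (@cayley_connected [set x | v x = v x1] x1) => // x s Ss /= vx.
  have := harm x; rewrite laplacianE// => /eqP.
  rewrite -oppr_eq0 -sumrN psumr_eq0; last first.
    by move=> t _; rewrite opprB subr_ge0 vx.
  move=> /allP/(_ s); rewrite in_fset_set// inE => /(_ Ss)/=.
  by rewrite oppr_eq0 subr_eq0 => /eqP ->.
apply: infG; apply: sub_finite_set finL => x _ /=.
by rewrite (vcst x) -(vcst x0) gtr0_norm.
Qed.

Lemma harmonic_vanishing_eq0 v : vanishing v -> (forall x, laplacian S v x = 0) ->
  forall x, v x = 0.
Proof.
move=> vanv harm x; apply/eqP; rewrite eq_le maximum_principle//=.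
rewrite -oppr_le0; apply: (@maximum_principle (fun x => - v x)).
  exact: vanishingN.
move=> y; rewrite laplacianE//; have := harm y; rewrite laplacianE// => h.
under eq_bigr do rewrite -opprD.
by rewrite sumrN h oppr0.
Qed.

Lemma superharmonic_gt0 v x1 : (forall x, 0 <= v x) ->
  (forall x, laplacian S v x <= 0) -> 0 < v x1 -> forall x, 0 < v x.
Proof.
move=> v0 sup v1 x; rewrite lt_neqAle v0 andbT; apply/eqP => vx.
suff : forall y, v y = 0 by move=> /(_ x1) vz; rewrite vz ltxx in v1.
apply: (@cayley_connected [set y | v y = 0] x) => // y s Ss /= vy.
have : laplacian S v y == 0.
  rewrite eq_le sup/= laplacianE//; apply: sumr_ge0 => t _.
  by rewrite vy subr0.
rewrite laplacianE// psumr_eq0; last by move=> t _; rewrite vy subr0.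
move=> /allP/(_ s); rewrite in_fset_set// inE => /(_ Ss)/=.
by rewrite vy subr0 => /eqP.
Qed.

End CayleyGraph.

(** * Solutions as Green potentials *)

Section Solutions.
Context {R : realType} {G : groupType} (S : set G) (N : nat) (C : R).
Implicit Types (f g u v w : G -> R) (x y : G).

Hypothesis hS : cayley_generators S.
Hypothesis infG : infinite_set [set: G].
Hypothesis N0 : (0 < N)%N.
Hypothesis C0 : 0 < C.
Hypothesis heat : heat_decay S N C.

Local Notation green := (green S).

Let S0 : S !=set0. Proof. exact: generators_nonempty. Qed.

Lemma laplacianB u v x :
  laplacian S (fun y => u y - v y) x = laplacian S u x - laplacian S v x.
Proof.
rewrite !laplacianE; try by case: hS.
by rewrite -sumrB; apply: eq_bigr => s _; ring.
Qed.

Definition pos_part u x : R := Num.max (u x) 0.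
Definition neg_part u x : R := Num.max (- u x) 0.

Lemma pos_part_ge0 u x : 0 <= pos_part u x.
Proof. by rewrite le_max lexx orbT. Qed.

Lemma neg_part_ge0 u x : 0 <= neg_part u x.
Proof. by rewrite le_max lexx orbT. Qed.

Lemma pos_neg_part u x : u x = pos_part u x - neg_part u x.
Proof. by rewrite /pos_part /neg_part; have [?|?] := leP (u x) 0; case: leP => ?; lra. Qed.

Lemma pos_part_le u x : pos_part u x <= `|u x|.
Proof. by rewrite ge_max ler_norm normr_ge0. Qed.

Lemma neg_part_le u x : neg_part u x <= `|u x|.
Proof. by rewrite ge_max normr_ge0 andbT -normrN ler_norm. Qed.

Lemma le_green f g x : (forall y, 0 <= f y) -> (forall y, f y <= g y) ->
  green_finite S g -> green f x <= green g x.
Proof.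
move=> f0 fg gf.
have g0 y : 0 <= g y by apply: le_trans (fg y).
have ff : green_finite S f := green_finite_le hS S0 fg gf.
rewrite -lee_fin -!green_seriesE//; apply: le_tsum => n.
have c0 : 0 < (2 * degree S)^-1 :> R.
  by rewrite invr_gt0 mulr_gt0// degree_gt0.
by rewrite ler_pM2l//; apply: le_walkn.
Qed.

Section Representation.
Variables p r a : R.
Hypothesis p1 : 1 <= p.
Hypothesis r0 : 0 < r.
Hypothesis gain : 2 / N%:R < p^-1 - r^-1.
Hypothesis a0 : 0 < a.
Variable w : G -> R.
Hypothesis wa : (tsum (fun x => `|w x| `^ a)%R < +oo)%E.
Local Notation D := (laplacian S w).
Hypothesis Dp : (tsum (fun x => `|D x| `^ p)%R < +oo)%E.

Let p0 : 0 <= p. Proof. exact: le_trans p1. Qed.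

Lemma pos_part_lp : (tsum (fun x => pos_part D x `^ p)%R < +oo)%E.
Proof.
exact: (tsum_powR_le p0 (pos_part_ge0 D) (pos_part_le D) Dp).
Qed.

Lemma neg_part_lp : (tsum (fun x => neg_part D x `^ p)%R < +oo)%E.
Proof.
exact: (tsum_powR_le p0 (neg_part_ge0 D) (neg_part_le D) Dp).
Qed.

Lemma pos_part_green : green_finite S (pos_part D).
Proof.
exact: (green_lp_finite hS S0 N0 C0 heat p1 r0 gain (pos_part_ge0 D) pos_part_lp).
Qed.

Lemma neg_part_green : green_finite S (neg_part D).
Proof.
exact: (green_lp_finite hS S0 N0 C0 heat p1 r0 gain (neg_part_ge0 D) neg_part_lp).
Qed.

Lemma green_vanishing f : (forall x, 0 <= f x) ->
  (tsum (fun x => f x `^ p)%R < +oo)%E -> vanishing (green f).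
Proof.
move=> f0 fp; apply: (vanishing_lp r0).
under eq_tsum => x do rewrite ger0_norm ?green_ge0//.
exact: (green_lp_lr hS S0 N0 C0 heat p1 r0 gain f0 fp).
Qed.

(** The difference of the two sides is harmonic and vanishes at infinity. *)
Lemma green_representation x : w x = green (neg_part D) x - green (pos_part D) x.
Proof.
apply/eqP; rewrite -subr_eq0; apply/eqP.
apply: (harmonic_vanishing_eq0 hS infG
    (v := fun x => w x - (green (neg_part D) x - green (pos_part D) x))).
  apply: vanishingD; first exact: (vanishing_lp a0).
  apply: vanishingN; apply: vanishingD.
    exact: (green_vanishing (neg_part_ge0 D) neg_part_lp).
  apply: vanishingN; exact: (green_vanishing (pos_part_ge0 D) pos_part_lp).
move=> y; rewrite !laplacianB !laplacian_green//.
- by rewrite {1}(pos_neg_part D y); ring.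
- exact: pos_part_ge0.
- exact: pos_part_green.
- exact: neg_part_ge0.
- exact: neg_part_green.
Qed.

Lemma green_abs_bound x : `|w x| <= green (fun y => `|D y|) x.
Proof.
have Df : green_finite S (fun y => `|D y|).
  exact: (green_lp_finite hS S0 N0 C0 heat p1 r0 gain (fun y => normr_ge0 _) Dp).
have hp := le_green x (pos_part_ge0 D) (pos_part_le D) Df.
have hn := le_green x (neg_part_ge0 D) (neg_part_le D) Df.
have gp := green_ge0 hS S0 x (pos_part_ge0 D).
have gn := green_ge0 hS S0 x (neg_part_ge0 D).
rewrite green_representation ler_norml; apply/andP; split; lra.
Qed.

End Representation.

Lemma abs_signed_power (r t : R) : 1 < r -> `|signed_power r t| = `|t| `^ (r - 1).
Proof.
move=> r1; rewrite /signed_power normrM (ger0_norm (powR_ge0 _ _)).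
have [->|t0] := eqVneq t 0.
  by rewrite normr0 mulr0 powR0// gt_eqF// subr_gt0.
rewrite mulrC -{1}(powRr1 (normr_ge0 t)) -powRD ?normr_eq0 ?t0 ?implybT//.
by congr (_ `^ _); ring.
Qed.

Lemma mul_signed_power (r t : R) : 1 < r -> t * signed_power r t = `|t| `^ r.
Proof.
move=> r1; rewrite /signed_power mulrCA -expr2 -[t ^+ 2]real_normK ?num_real//.
have [->|t0] := eqVneq t 0.
  by rewrite normr0 expr0n/= mulr0 powR0// gt_eqF// (lt_trans ltr01).
rewrite -(powR_mulrn 2 (normr_ge0 _)) -powRD ?normr_eq0 ?t0 ?implybT//.
by rewrite subrK.
Qed.

Section Identity.
Variables p q : R.
Hypothesis p1 : 1 < p.
Hypothesis q0 : 0 < q.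
Hypothesis gain : 2 / N%:R < p^-1 - q^-1.

Let p0 : 0 < p. Proof. exact: lt_trans p1. Qed.
Let pq : p < q. Proof. exact: (gain_lt N0 (ltW p1) q0 gain). Qed.
Let q1 : 1 < q. Proof. exact: lt_trans p1 pq. Qed.
Let p' : R := p / (p - 1).
Let q' : R := q / (q - 1).
Let pm1 : 0 < p - 1. Proof. by rewrite subr_gt0. Qed.
Let qm1 : 0 < q - 1. Proof. by rewrite subr_gt0. Qed.
Let q'1 : 1 <= q'. Proof. exact: (dual_exponent_ge1 N0 p1 q0 gain). Qed.
Let p'0 : 0 < p'. Proof. exact: (dual_exponent_gt0 p1). Qed.
Let gain' : 2 / N%:R < q'^-1 - p'^-1. Proof. exact: (dual_gain N0 p1 q0 gain). Qed.

Lemma tsum_conjugate_finite f h : (forall x, 0 <= f x) -> (forall x, 0 <= h x) ->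
  (tsum (fun x => f x `^ p)%R < +oo)%E -> (tsum (fun x => h x `^ p')%R < +oo)%E ->
  (tsum (fun x => f x * h x)%R < +oo)%E.
Proof.
move=> f0 h0 ffin hfin.
have key x : p * (f x * h x) <= f x `^ p + (p - 1) * h x `^ p'.
  have := powR_tangent (ltW p1) (powR_ge0 (h x) (p - 1)^-1) (f0 x).
  rewrite powRVK ?gt_eqF// -powRrM [_^-1 * p]mulrC -/p' => h1.
  by apply: le_trans h1; rewrite le_eqVlt; apply/orP; left; apply/eqP; ring.
have := le_tsum key; rewrite tsumZ ?(ltW p0)//; last by move=> x; rewrite mulr_ge0.
rewrite tsumD; last 2 first.
- by move=> x; exact: powR_ge0.
- by move=> x; rewrite mulr_ge0 ?powR_ge0 ?(ltW pm1).
rewrite tsumZ ?(ltW pm1)//; last by move=> x; exact: powR_ge0.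
rewrite -lee_pdivlMl// => /le_lt_trans; apply.
rewrite (tsum_fineK _ ffin); last by move=> x; exact: powR_ge0.
rewrite (tsum_fineK _ hfin); last by move=> x; exact: powR_ge0.
by rewrite -!EFinM ltry.
Qed.

Variable a : R.
Hypothesis a0 : 0 < a.
Hypothesis aq : a <= q.
Variable w : G -> R.
Hypothesis wa : (tsum (fun x => `|w x| `^ a)%R < +oo)%E.
Local Notation D := (laplacian S w).
Hypothesis Dp : (tsum (fun x => `|D x| `^ p)%R < +oo)%E.
Hypothesis sol : p_biharmonic_solution S p q w.

Let phi x : R := signed_power p (D x).
Local Notation E := (laplacian S phi).

Let EE x : E x = signed_power q (w x).
Proof. by apply/eqP; rewrite -subr_eq0; apply/eqP; exact: sol. Qed.

Lemma solution_lq : (tsum (fun x => `|w x| `^ q)%R < +oo)%E.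
Proof. exact: (lp_embedding a0 aq (fun x => normr_ge0 _) wa). Qed.

Let phip : (tsum (fun x => `|phi x| `^ p')%R < +oo)%E.
Proof.
under eq_tsum => x.
  rewrite abs_signed_power// -powRrM /p' mulrC divfK ?gt_eqF//.
  over.
exact: Dp.
Qed.

Let Eq : (tsum (fun x => `|E x| `^ q')%R < +oo)%E.
Proof.
under eq_tsum => x.
  rewrite EE abs_signed_power// -powRrM /q' mulrC divfK ?gt_eqF//.
  over.
exact: solution_lq.
Qed.

(** Write phi = |Delta w|^(p-2) Delta w, so that Delta phi = |w|^(q-2) w.  Both w
    and phi are potentials, and sum (Delta w) phi = sum w (Delta phi) is the
    symmetry of K.  Direct summation by parts is not available, since
    w need not lie in the dual of the space of phi.  Splitting into positive and
    negative parts reduces the identity to sums of nonnegative terms. *)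
Theorem solution_identity :
  tsum (fun x => `|D x| `^ p) = tsum (fun x => `|w x| `^ q).
Proof.
pose Dp' := pos_part D; pose Dn := neg_part D.
pose Ep := pos_part E; pose En := neg_part E.
have Dp0 : forall x, 0 <= Dp' x by exact: pos_part_ge0.
have Dn0 : forall x, 0 <= Dn x by exact: neg_part_ge0.
have Ep0 : forall x, 0 <= Ep x by exact: pos_part_ge0.
have En0 : forall x, 0 <= En x by exact: neg_part_ge0.
have Dpf : green_finite S Dp' := pos_part_green (ltW p1) q0 gain Dp.
have Dnf : green_finite S Dn := neg_part_green (ltW p1) q0 gain Dp.
have Epf : green_finite S Ep := pos_part_green q'1 p'0 gain' Eq.
have Enf : green_finite S En := neg_part_green q'1 p'0 gain' Eq.
have KDp0 x : 0 <= green Dp' x by exact: green_ge0.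
have KDn0 x : 0 <= green Dn x by exact: green_ge0.
have KEp0 x : 0 <= green Ep x by exact: green_ge0.
have KEn0 x : 0 <= green En x by exact: green_ge0.
have wrep x : w x = green Dn x - green Dp' x.
  exact: (green_representation (ltW p1) q0 gain a0 wa Dp).
have phirep x : phi x = green En x - green Ep x.
  exact: (green_representation q'1 p'0 gain' p'0 phip Eq).
have KEpf : (tsum (fun x => green Ep x `^ p')%R < +oo)%E.
  exact: (green_lp_lr hS S0 N0 C0 heat q'1 p'0 gain' Ep0 (pos_part_lp q'1 Eq)).
have KEnf : (tsum (fun x => green En x `^ p')%R < +oo)%E.
  exact: (green_lp_lr hS S0 N0 C0 heat q'1 p'0 gain' En0 (neg_part_lp q'1 Eq)).
pose X := (tsum (fun x => Dn x * green En x)%R + tsum (fun x => Dp' x * green Ep x)%R)%E.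
pose Y := (tsum (fun x => Dp' x * green En x)%R + tsum (fun x => Dn x * green Ep x)%R)%E.
have Xfin : X \is a fin_num.
  rewrite fin_numD; apply/andP; split; rewrite ge0_fin_numE.
  - exact: (tsum_conjugate_finite _ _ (neg_part_lp (ltW p1) Dp)).
  - by apply: tsum_ge0 => x; rewrite mulr_ge0.
  - exact: (tsum_conjugate_finite _ _ (pos_part_lp (ltW p1) Dp)).
  - by apply: tsum_ge0 => x; rewrite mulr_ge0.
have lhs : (tsum (fun x => `|D x| `^ p)%R + X = Y)%E.
  rewrite /X /Y -!tsumD; try by move=> x; rewrite ?addr_ge0 ?mulr_ge0 ?powR_ge0.
  apply: eq_tsum => x; rewrite -mul_signed_power// -/(phi x) phirep.
  by rewrite {1}(pos_neg_part D x) -/(Dp' x) -/(Dn x); ring.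
have rhs : (tsum (fun x => `|w x| `^ q)%R + X = Y)%E.
  rewrite /X /Y !green_dual// -!tsumD;
    try by move=> x; rewrite ?addr_ge0 ?mulr_ge0 ?powR_ge0.
  apply: eq_tsum => x; rewrite -mul_signed_power// -EE wrep.
  by rewrite {1}(pos_neg_part E x) -/(Ep x) -/(En x); ring.
move: lhs; rewrite -rhs -(fineK Xfin).
rewrite (tsum_fineK _ Dp); last by move=> x; exact: powR_ge0.
rewrite (tsum_fineK _ solution_lq); last by move=> x; exact: powR_ge0.
by rewrite -!EFinD => -[/addIr ->].
Qed.

End Identity.

End Solutions.

(** * Summability of the extremal function at the critical exponent *)

Section Bootstrap.
Context {R : realType} {G : groupType} (S : set G) (N : nat) (C : R).
Implicit Types (f g u : G -> R) (x y : G).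

Hypothesis hS : cayley_generators S.
Hypothesis S0 : S !=set0.
Hypothesis N0 : (0 < N)%N.
Hypothesis C0 : 0 < C.
Hypothesis heat : heat_decay S N C.

Local Notation green := (green S).

Variables p q : R.
Hypothesis p1 : 1 < p.
Hypothesis q0 : 0 < q.
Hypothesis gain : 2 / N%:R < p^-1 - q^-1.

Let p0 : 0 < p. Proof. exact: lt_trans p1. Qed.
Let pq : p < q. Proof. exact: (gain_lt N0 (ltW p1) q0 gain). Qed.
Let q1 : 1 < q. Proof. exact: lt_trans p1 pq. Qed.
Let pm1 : 0 < p - 1. Proof. by rewrite subr_gt0. Qed.
Let qm1 : 0 < q - 1. Proof. by rewrite subr_gt0. Qed.

(** The estimate K : l^p -> l^r is strict and misses the critical exponent r.  But
    q exceeds it strictly, so going once around the equation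
    f^(p-1) = lambda K ((K f)^(q-1)) improves the summability of f from p to
    some p3 < p, and K maps l^p3 to l^r. *)
Lemma extremal_critical_summable f (lambda r : R) : 0 <= lambda ->
  (forall y, 0 <= f y) -> (tsum (fun y => f y `^ p)%R < +oo)%E ->
  (forall x, f x `^ (p - 1) = lambda * green (fun y => green f y `^ (q - 1)) x) ->
  0 < r -> r^-1 = p^-1 - 2 / N%:R ->
  (tsum (fun y => green f y `^ r)%R < +oo)%E.
Proof.
move=> l0 f0 fp EL r0 rE.
have b0 : q^-1 < p^-1 - 2 / N%:R by rewrite ltrBrDr addrC -ltrBrDr.
have N20 : 0 < 2 / N%:R :> R by rewrite divr_gt0// ltr0n.
have qi0 : 0 < q^-1 by rewrite invr_gt0.
(* s, mi and si are reciprocals of exponents, as the condition of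
   green_sobolev is linear in these *)
pose s : R := (q^-1 + (p^-1 - 2 / N%:R)) / 2.
have sq : q^-1 < s by rewrite /s; lra.
have sb : s < p^-1 - 2 / N%:R by rewrite /s; lra.
have s0 : 0 < s by exact: lt_trans sq.
have u0 y : 0 <= green f y by exact: green_ge0.
have us : (tsum (fun y => green f y `^ s^-1)%R < +oo)%E.
  apply: (green_lp_lr hS S0 N0 C0 heat (ltW p1) _ _ f0 fp); rewrite ?invr_gt0// invrK; lra.
(* 1 / mi is an exponent, at least 1 and less than q / (q - 1), in which
   u^(q - 1) is summable *)
pose mi : R := Num.min 1 ((q - 1) * s).
have mi1 : mi <= 1 by rewrite ge_min lexx.
have mis : mi <= (q - 1) * s by rewrite ge_min lexx orbT.
have miq : 1 - q^-1 < mi.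
  rewrite lt_min; apply/andP; split; first by lra.
  have -> : 1 - q^-1 = (q - 1) * q^-1 by rewrite mulrBl mulfV ?gt_eqF// mul1r.
  by rewrite ltr_pM2l.
have mi0 : 0 < mi by rewrite lt_min ltr01 mulr_gt0.
have um : (tsum (fun y => (green f y `^ (q - 1)) `^ mi^-1)%R < +oo)%E.
  under eq_tsum do rewrite -powRrM.
  apply: (lp_embedding _ _ u0 us); first by rewrite invr_gt0.
  by rewrite -[leLHS]mul1r ler_pdivrMr// mulrAC ler_pdivlMr// mul1r.
(* the potential is then summable with an exponent 1 / si < p / (p - 1) *)
pose si : R := ((1 - p^-1) + (mi - 2 / N%:R)) / 2.
have mp : 1 - p^-1 < mi - 2 / N%:R by lra.
have sip : 1 - p^-1 < si by rewrite /si; lra.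
have sim : si < mi - 2 / N%:R by rewrite /si; lra.
have pi1 : p^-1 < 1 by rewrite invf_lt1.
have si0 : 0 < si by lra.
have Ks : (tsum (fun x => green (fun y => green f y `^ (q - 1)) x `^ si^-1)%R < +oo)%E.
  apply: (green_lp_lr hS S0 N0 C0 heat _ _ _ _ um).
  - by rewrite invf_ge1.
  - by rewrite invr_gt0.
  - by rewrite !invrK; lra.
  - by move=> y; exact: powR_ge0.
have K0 x : 0 <= green (fun y => green f y `^ (q - 1)) x.
  by apply: green_ge0 => // y; exact: powR_ge0.
pose p2 := si^-1 * (p - 1).
have p20 : 0 < p2 by rewrite mulr_gt0 ?invr_gt0.
have p2p : p2 < p.
  rewrite /p2 mulrC ltr_pdivrMr//.
  have -> : p - 1 = p * (1 - p^-1) by rewrite mulrBr mulr1 mulfV ?gt_eqF.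
  by rewrite ltr_pM2l.
have fp2 : (tsum (fun y => f y `^ p2)%R < +oo)%E.
  rewrite (@eq_tsum _ _ _ (fun x => lambda `^ si^-1 *
      green (fun y => green f y `^ (q - 1)) x `^ si^-1)); last first.
    by move=> x; rewrite /p2 mulrC powRrM EL powRM.
  rewrite tsumZ ?powR_ge0//; last by move=> x; exact: powR_ge0.
  rewrite (tsum_fineK _ Ks); last by move=> x; exact: powR_ge0.
  by rewrite -EFinM ltry.
pose p3 : R := Num.max 1 p2.
have p31 : 1 <= p3 by rewrite le_max lexx.
have p23 : p2 <= p3 by rewrite le_max lexx orbT.
have p3p : p3 < p by rewrite gt_max p1 p2p.
have p30 : 0 < p3 by exact: lt_le_trans p31.
have fp3 := lp_embedding p20 p23 f0 fp2.
apply: (green_lp_lr hS S0 N0 C0 heat p31 r0 _ f0 fp3).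
have : p^-1 < p3^-1 by rewrite ltf_pV2.
rewrite rE; lra.
Qed.

End Bootstrap.

(** * The energy in terms of sums *)

Section Energy.
Context {R : realType} {G : groupType} (S : set G).
Implicit Types (u w : G -> R) (r p q A : R).

Lemma lp_norm_finite r u : 0 < r ->
  (lp_norm r u < +oo)%E <-> (tsum (fun x => `|u x| `^ r)%R < +oo)%E.
Proof.
move=> r0; rewrite /lp_norm -/(tsum (fun x => `|u x| `^ r)).
have s0 : (0 <= tsum (fun x => `|u x| `^ r)%R)%E.
  by apply: tsum_ge0 => x; exact: powR_ge0.
case E : (tsum _) s0 => [s| |]// _.
  by rewrite poweR_EFin !ltry.
by rewrite poweRyr // gt_eqF ?invr_gt0.
Qed.

Lemma lp_norm_poweR r u A : 0 < r -> tsum (fun x => `|u x| `^ r) = A%:E ->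
  (lp_norm r u `^ r)%E = A%:E.
Proof.
move=> r0 uA; have A0 : 0 <= A.
  by rewrite -lee_fin -uA; apply: tsum_ge0 => x; exact: powR_ge0.
rewrite /lp_norm -/(tsum (fun x => `|u x| `^ r)) uA !poweR_EFin.
by rewrite powRVK ?gt_eqF.
Qed.

Lemma energyE p q w A : 0 < p -> 0 < q ->
  tsum (fun x => `|laplacian S w x| `^ p) = A%:E ->
  tsum (fun x => `|w x| `^ q) = A%:E ->
  energy S p q w = ((p^-1 - q^-1) * A)%:E.
Proof.
move=> p0 q0 hD hw; rewrite /energy (lp_norm_poweR p0 hD) (lp_norm_poweR q0 hw).
by rewrite -!EFinM -EFinB -mulrBl.
Qed.

End Energy.

(** * The ground state *)

Section GroundState.
Context {R : realType} {G : groupType} (S : set G) (N : nat) (C : R).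
Implicit Types (f g u w : G -> R) (x y : G).

Hypothesis hS : cayley_generators S.
Hypothesis infG : infinite_set [set: G].
Hypothesis N0 : (0 < N)%N.
Hypothesis C0 : 0 < C.
Hypothesis heat : heat_decay S N C.

Local Notation green := (green S).
Let S0 : S !=set0. Proof. exact: generators_nonempty. Qed.

Variables p q : R.
Hypothesis p1 : 1 < p.
Hypothesis q0 : 0 < q.
Hypothesis gain : 2 / N%:R < p^-1 - q^-1.

Let p0 : 0 < p. Proof. exact: lt_trans p1. Qed.
Let pq : p < q. Proof. exact: (gain_lt N0 (ltW p1) q0 gain). Qed.
Let q1 : 1 < q. Proof. exact: lt_trans p1 pq. Qed.
Let qp0 : 0 < q - p. Proof. by rewrite subr_gt0. Qed.

Local Notation M := (sobolev_sup S p q).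
Let M0 : 0 < M. Proof. exact: (sobolev_sup_gt0 hS S0 N0 C0 heat p1 q0 gain). Qed.

(** The factor t for which t f solves the equation without the constant 1/M:
    both sides are homogeneous, of degrees p - 1 and q - 1. *)
Definition ground_scale : R := M^-1 `^ (q - p)^-1.
Local Notation t := ground_scale.

Lemma ground_scale_gt0 : 0 < t.
Proof. by rewrite powR_gt0// invr_gt0. Qed.

Lemma ground_scale_eq : t `^ (q - p) = M^-1.
Proof. by rewrite powRVK ?invr_ge0 ?(ltW M0)// gt_eqF. Qed.

(** With A = k^p, the Sobolev inequality and solution_identity give
    k^p <= M k^q, that is k >= t. *)
Lemma solution_energy_lower (a : R) w : 0 < a -> a <= q ->
  (tsum (fun x => `|w x| `^ a)%R < +oo)%E ->
  (tsum (fun x => `|laplacian S w x| `^ p)%R < +oo)%E ->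
  w <> (fun=> 0) -> p_biharmonic_solution S p q w ->
  exists2 A, t `^ p <= A & energy S p q w = ((p^-1 - q^-1) * A)%:E.
Proof.
move=> a0 aq wa Dp w0 sol.
have id := solution_identity hS infG N0 C0 heat p1 q0 gain a0 aq wa Dp sol.
pose A := fine (tsum (fun x => `|laplacian S w x| `^ p)).
have DA : tsum (fun x => `|laplacian S w x| `^ p) = A%:E.
  by apply: tsum_fineK => // x; exact: powR_ge0.
have wA : tsum (fun x => `|w x| `^ q) = A%:E by rewrite -id.
exists A; last exact: energyE.
have Age : 0 <= A by rewrite -lee_fin -DA; apply: tsum_ge0 => x; exact: powR_ge0.
have A0 : 0 < A.
  rewrite lt_neqAle eq_sym Age andbT; apply/eqP => Az; apply: w0.
  apply/funext => x; apply/normr0_eq0/(@powR_eq0_eq0 _ _ q).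
  apply/eqP; rewrite eq_le powR_ge0 andbT -lee_fin -[X in (_ <= X%:E)%E]Az -wA.
  exact: (term_le_tsum (fun x => `|w x| `^ q)).
pose k := A `^ p^-1.
have k0 : 0 < k by exact: powR_gt0.
have kp : k `^ p = A by rewrite /k powRVK ?(ltW A0)// gt_eqF.
have hk : k `^ p <= M * k `^ q.
  rewrite kp -lee_fin -wA.
  apply: (@le_trans _ _ (tsum (fun x =>
      green (fun y => `|laplacian S w y|) x `^ q))).
    apply: le_tsum => x; apply: ler_powR_base; rewrite ?(ltW q0)//.
    exact: (green_abs_bound hS infG N0 C0 heat (ltW p1) q0 gain a0 wa Dp).
  apply: (sobolev_sup_ineq hS S0 N0 C0 heat p1 q0 gain k0) => //.
  by rewrite kp DA.
rewrite -kp; apply: ler_powR_base; rewrite ?(ltW p0) ?(ltW ground_scale_gt0)//.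
apply: (powR_lerP qp0 (ltW ground_scale_gt0) (ltW k0)).
rewrite ground_scale_eq powRB ?(gt_eqF k0) ?implybT//.
by rewrite ler_pdivlMr ?powR_gt0// ler_pdivrMl.
Qed.

Lemma ground_state_exists (r : R) : 0 < r -> r^-1 = p^-1 - 2 / N%:R ->
  exists u, [/\ forall x, 0 < u x,
    (tsum (fun x => `|u x| `^ r)%R < +oo)%E,
    (tsum (fun x => `|laplacian S u x| `^ p)%R < +oo)%E,
    p_biharmonic_solution S p q u &
    energy S p q u = ((p^-1 - q^-1) * t `^ p)%:E].
Proof.
move=> r0 rE.
have [f [f0 f1 uM EL]] := extremal_exists hS S0 N0 C0 heat p1 q0 gain.
have t0 := ground_scale_gt0; have t0' := ltW t0.
have ffin : (tsum (fun y => f y `^ p)%R < +oo)%E by rewrite f1 ltry.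
have ff : green_finite S f.
  exact: (green_lp_finite hS S0 N0 C0 heat (ltW p1) q0 gain f0 ffin).
have u0 y : 0 <= green f y by exact: green_ge0.
have ufin : (tsum (fun y => green f y `^ q)%R < +oo)%E by rewrite uM ltry.
have uqf : green_finite S (fun y => green f y `^ (q - 1)).
  exact: (powR_green_finite hS S0 N0 C0 heat p1 q0 gain u0 ufin).
have uq0 y : 0 <= green f y `^ (q - 1) by exact: powR_ge0.
pose F y := t * f y; pose u := green F.
have F0 y : 0 <= F y by rewrite mulr_ge0.
have uE y : u y = t * green f y by rewrite /u greenZ.
have Ffin : green_finite S F.
  apply: (green_lp_finite hS S0 N0 C0 heat (ltW p1) q0 gain F0).
  rewrite (@eq_tsum _ _ _ (fun y => t `^ p * f y `^ p)); last first.
    by move=> y; rewrite powRM.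
  by rewrite tsumZ ?powR_ge0// ?f1 ?mule1 ?ltry// => y; exact: powR_ge0.
have lapu y : laplacian S u y = - F y by exact: laplacian_green.
have uge0 y : 0 <= u y by rewrite uE mulr_ge0.
have upos : forall x, 0 < u x.
  have [x1 hx1] : exists x1, 0 < u x1.
    apply: contrapT => no.
    have uz y : green f y = 0.
      apply/eqP; rewrite eq_le u0 andbT leNgt; apply/negP => h; apply: no.
      by exists y; rewrite uE mulr_gt0.
    have : tsum (fun y => green f y `^ q) = 0%E.
      rewrite (@eq_tsum _ _ _ (fun=> 0)); first by rewrite /tsum esum1.
      by move=> y; rewrite uz powR0// gt_eqF.
    by rewrite uM => -[] /eqP; rewrite gt_eqF.
  apply: (superharmonic_gt0 hS uge0 _ hx1) => x.
  by rewrite lapu oppr_le0.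
have dataD : tsum (fun x => `|laplacian S u x| `^ p) = (t `^ p)%:E.
  rewrite (@eq_tsum _ _ _ (fun y => t `^ p * f y `^ p)); last first.
    by move=> y; rewrite lapu normrN ger0_norm// powRM.
  by rewrite tsumZ ?powR_ge0// ?f1 ?mule1// => y; exact: powR_ge0.
have tM : t `^ q * M = t `^ p.
  have -> : t `^ q = t `^ p * t `^ (q - p).
    by rewrite -powRD ?(gt_eqF t0) ?implybT// addrC subrK.
  by rewrite ground_scale_eq mulfVK ?gt_eqF.
have dataw : tsum (fun x => `|u x| `^ q) = (t `^ p)%:E.
  rewrite (@eq_tsum _ _ _ (fun y => t `^ q * green f y `^ q)); last first.
    by move=> y; rewrite ger0_norm// uE powRM.
  by rewrite tsumZ ?powR_ge0// ?uM -?EFinM ?tM// => y; exact: powR_ge0.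
exists u; split => //.
- have Mi0 : 0 <= M^-1 by rewrite invr_ge0 ltW.
  have h := extremal_critical_summable hS S0 N0 C0 heat p1 q0 gain
    Mi0 f0 ffin EL r0 rE.
  rewrite (@eq_tsum _ _ _ (fun y => t `^ r * green f y `^ r)); last first.
    by move=> y; rewrite ger0_norm// uE powRM.
  rewrite tsumZ ?powR_ge0//; last by move=> y; exact: powR_ge0.
  by rewrite (tsum_fineK _ h) -?EFinM ?ltry// => y; exact: powR_ge0.
- by rewrite dataD ltry.
- move=> x; apply/eqP; rewrite subr_eq0; apply/eqP.
  have -> : (fun y => signed_power p (laplacian S u y)) =
      (fun y => 0 - green (fun z => u z `^ (q - 1)) y).
    apply/funext => y; rewrite sub0r.
    have -> : (fun z => u z `^ (q - 1)) =
        (fun z => t `^ (q - 1) * green f z `^ (q - 1)).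
      by apply/funext => z; rewrite uE powRM.
    rewrite greenZ ?powR_ge0//.
    have -> : t `^ (q - 1) = t `^ (p - 1) * M^-1.
      rewrite -ground_scale_eq -powRD ?(gt_eqF t0) ?implybT//.
      by congr (_ `^ _); ring.
    rewrite -mulrA -EL -powRM// -/(F y) lapu.
    have -> : signed_power p (- F y) = - signed_power p (F y).
      by rewrite /signed_power normrN mulrN.
    congr (- _); have := abs_signed_power (F y) p1.
    by rewrite (ger0_norm (F0 y)) ger0_norm// mulr_ge0 ?powR_ge0.
  rewrite laplacianB//.
  have -> : laplacian S (fun=> 0 : R) x = 0.
    by rewrite laplacianE; [rewrite big1// => s _; rewrite subrr|case: hS].
  have Uq0 y : 0 <= u y `^ (q - 1) by exact: powR_ge0.
  have Uqf : green_finite S (fun y => u y `^ (q - 1)).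
    apply: (powR_green_finite hS S0 N0 C0 heat p1 q0 gain uge0).
    have := dataw; under eq_tsum => y do rewrite ger0_norm//.
    by move=> ->; rewrite ltry.
  rewrite (laplacian_green hS S0 x Uq0 Uqf) sub0r opprK.
  have := abs_signed_power (u x) q1.
  by rewrite (ger0_norm (uge0 x)) ger0_norm// mulr_ge0 ?powR_ge0.
- exact: energyE dataD dataw.
Qed.

End GroundState.

Theorem corollary2 (R : realType) (G : groupType) (S : set G) (N : nat)
    (p q : R)
    (hS : cayley_generators S)
    (hgrowth : polynomial_growth R S N)
    (hN : (3 <= N)%N)
    (hp1 : 1 < p) (hpN : p < N%:R / 2)
    (hq : critical_exponent N p < q) :
  exists u : G -> R,
    [/\ D2 S N p u, (forall x : G, 0 < u x) & ground_state S N p q u].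
Proof.
have N0 : (0 < N)%N by exact: leq_trans hN.
have N2 : (2 <= N)%N by exact: leq_trans hN.
have NR : 0 < N%:R :> R by rewrite ltr0n.
have p0 : 0 < p by exact: lt_trans hp1.
have infG : infinite_set [set: G] by exact: polynomial_growth_infinite hgrowth.
have S0 := generators_nonempty hS infG.
have [C C0 heat] := heat_bound hS S0 N2 hgrowth.
have d0 : 0 < N%:R - 2 * p by lra.
have r0 : 0 < critical_exponent N p by rewrite /critical_exponent divr_gt0// mulr_gt0.
set r := critical_exponent N p in hq r0.
have rE : r^-1 = p^-1 - 2 / N%:R.
  by rewrite /r /critical_exponent; field; rewrite !gt_eqF.
have q0 : 0 < q by exact: lt_trans hq.
have gain : 2 / N%:R < p^-1 - q^-1.
  have : q^-1 < r^-1 by rewrite ltf_pV2.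
  rewrite rE; lra.
have pq : p < q := gain_lt N0 (ltW hp1) q0 gain.
have [u [upos ur uD usol uE]] :=
  ground_state_exists hS infG N0 C0 heat hp1 q0 gain r0 rE.
have uD2 : D2 S N p u by split; apply/lp_norm_finite.
exists u; split => //; split; first split => //.
  by move=> u0; have := upos 1%g; rewrite u0 ltxx.
move=> w [[wr wD] w0 wsol].
have /(lp_norm_finite _ r0) wr' := wr.
have /(lp_norm_finite _ p0) wD' := wD.
have [A tA wE] := solution_energy_lower hS infG N0 C0 heat hp1 q0 gain
  r0 (ltW hq) wr' wD' w0 wsol.
by rewrite uE wE lee_fin ler_wpM2l// subr_ge0 lef_pV2 ?posrE// ltW.
Qed.
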